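(* Let $n\ge 2$ and let $H=H_1\ast\cdots\ast H_n$ be the free product of non-trivial groups $H_1,\dots,H_n$, each of which satisfies a non-trivial law, and suppose that $H\not\simeq D_\infty$. Then $H$ is strongly verbally closed.
   Context: $D_\infty$ is the infinite dihedral group (the free product of two groups of order two). $F_n(x_1,\dots,x_n)$ is the free group with basis $x_1,\dots,x_n$. A group $G$ satisfies the law $I\in F_r(x_1,\dots,x_r)$ if $I(g_1,\dots,g_r)=1$ for all $g_1,\dots,g_r\in G$; the law is non-trivial if $I\ne 1$ in $F_r$. A subgroup $H$ of a group $G$ is verbally closed in $G$ if any equation $w(x_1,\dots,x_n)=h$ with $w\in F_n(x_1,\dots,x_n)$ and $h\in H$ having a solution in $G$ has a solution in $H$. A subgroup $H$ of $G$ is algebraically closed in $G$ if any finite system of equations $\{w_1(x_1,\dots,x_n,H)=1,\dots,w_m(x_1,\dots,x_n,H)=1\}$ with $w_i(x_1,\dots,x_n,H)\in F_n(x_1,\dots,x_n)\ast H$ having a solution in $G$ has a solution in $H$. A group $H$ is strongly verbally closed if $H$ is algebraically closed in any group containing $H$ as a verbally closed subgroup. *)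

(* Defs.v *)
From HB Require Import structures.
From mathcomp Require Import all_boot zmodp.
From mathcomp Require Import boolp.

Set Implicit Arguments.
Unset Strict Implicit.
Unset Printing Implicit Defensive.

Local Open Scope group_scope.
Local Open Scope quotient_scope.

(* Possibly infinite groups are rendered by MathComp's [groupType].  The      *)
(* choice structure it carries is no restriction, since classical choice is   *)
(* available through [boolp].                                                 *)

Section Presentation.
Variable T : choiceType.

(* The letter (t, false) stands for the generator t, (t, true) for t^-1. *)
Definition word := seq (T * bool).

Definition inv_letter (l : T * bool) := (l.1, ~~ l.2).

Variable R : word -> word -> Prop.

(* Equality of words in the group < T | s = t whenever R s t >. *)
Inductive word_eq : word -> word -> Prop :=
| WordRefl u : word_eq u u
| WordSym u v : word_eq u v -> word_eq v u
| WordTrans v u w : word_eq u v -> word_eq v w -> word_eq u w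
| WordCancel u l v : word_eq (u ++ l :: inv_letter l :: v) (u ++ v)
| WordRel u s t v : R s t -> word_eq (u ++ s ++ v) (u ++ t ++ v).

Definition word_eqb (u v : word) : bool := `[< word_eq u v >].

Fact word_eqb_refl : reflexive word_eqb.
Proof. by move=> u; apply/asboolP; constructor. Qed.

Fact word_eqb_sym : symmetric word_eqb.
Proof. by move=> u v; apply/asboolP/asboolP; apply: WordSym. Qed.

Fact word_eqb_trans : transitive word_eqb.
Proof.
by move=> v u w /asboolP uv /asboolP vw; apply/asboolP; apply: WordTrans uv vw.
Qed.

Canonical word_equiv :=
  EquivRel word_eqb word_eqb_refl word_eqb_sym word_eqb_trans.

Definition presented := {eq_quot word_equiv}.

HB.instance Definition _ := Choice.on presented.
HB.instance Definition _ := EqQuotient.on presented.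

Definition word_class (u : word) : presented := \pi_presented%qT u.

Definition pgen (t : T) : presented := word_class [:: (t, false)].

Lemma word_classP u v : word_class u = word_class v <-> word_eq u v.
Proof. by split=> [/eqmodP/asboolP|uv]; last exact/eqmodP/asboolP. Qed.

Lemma repr_word_class u : word_eq (repr (word_class u)) u.
Proof. by apply/word_classP; rewrite /word_class reprK. Qed.

Lemma word_classK x : word_class (repr x) = x.
Proof. exact: reprK. Qed.

Lemma word_eq_cat u u' v v' :
  word_eq u u' -> word_eq v v' -> word_eq (u ++ v) (u' ++ v').
Proof.
move=> uu' vv'; apply: (@WordTrans (u' ++ v)).
  elim: uu' => {u u'} [u|u w _|w u t _ + _|u l w|u s t w st].
  - exact: WordRefl.
  - exact: WordSym.
  - exact: WordTrans.
  - by rewrite -!catA; apply: WordCancel.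
  - by rewrite -!catA; apply: WordRel.
elim: vv' => {v v'} [v|v w _|w v t _ + _|v l w|v s t w st].
- exact: WordRefl.
- exact: WordSym.
- exact: WordTrans.
- by rewrite !catA; apply: WordCancel.
- by rewrite !(catA u'); apply: WordRel.
Qed.

Definition inv_word (u : word) : word := rev (map inv_letter u).

Lemma inv_letterK : involutive inv_letter.
Proof. by case=> t b; rewrite /inv_letter negbK. Qed.

Lemma inv_wordK : involutive inv_word.
Proof.
by move=> u; rewrite /inv_word map_rev revK -map_comp map_id_in // => l _;
  apply: inv_letterK.
Qed.

Lemma word_eq_mulV u : word_eq (u ++ inv_word u) [::].
Proof.
elim: u => [|l u IHu]; first exact: WordRefl.
have -> : (l :: u) ++ inv_word (l :: u)
    = [:: l] ++ (u ++ inv_word u) ++ [:: inv_letter l].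
  by rewrite /inv_word /= rev_cons -cats1 -catA.
apply: (@WordTrans ([:: l] ++ [::] ++ [:: inv_letter l])).
  apply: word_eq_cat; first exact: WordRefl.
  by apply: word_eq_cat => //; apply: WordRefl.
exact: (@WordCancel [::] l [::]).
Qed.

Lemma word_eq_Vmul u : word_eq (inv_word u ++ u) [::].
Proof. by rewrite -{2}[u]inv_wordK; apply: word_eq_mulV. Qed.

Definition pone : presented := word_class [::].
Definition pmul (x y : presented) := word_class (repr x ++ repr y).
Definition pinv (x : presented) := word_class (inv_word (repr x)).

Lemma word_class_cat u v : word_class (u ++ v) = pmul (word_class u) (word_class v).
Proof.
by apply/word_classP/WordSym; apply: word_eq_cat; apply: repr_word_class.
Qed.

Fact pmulA : associative pmul.
Proof.
move=> x y z; rewrite -[x]word_classK -[y]word_classK -[z]word_classK.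
by rewrite -!word_class_cat catA.
Qed.

Fact pmul1 : left_id pone pmul.
Proof. by move=> x; rewrite -[x]word_classK -word_class_cat. Qed.

Fact pmulr1 : right_id pone pmul.
Proof. by move=> x; rewrite -[x]word_classK -word_class_cat cats0. Qed.

Fact pmulV : left_inverse pone pinv pmul.
Proof.
move=> x; rewrite -{2}[x]word_classK -word_class_cat.
by apply/word_classP; apply: word_eq_Vmul.
Qed.

Fact pmulrV : right_inverse pone pinv pmul.
Proof.
move=> x; rewrite -{1}[x]word_classK -word_class_cat.
by apply/word_classP; apply: word_eq_mulV.
Qed.

HB.instance Definition _ :=
  isGroup.Build presented pmulA pmul1 pmulr1 pmulV pmulrV.

Section Lift.
Variables (G : groupType) (phi : T -> G).

Definition eval_letter (l : T * bool) : G :=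
  if l.2 then (phi l.1)^-1 else phi l.1.

Definition eval_word (u : word) : G := \prod_(l <- u) eval_letter l.

(* The homomorphism with [pgen t |-> phi t]; it is one as soon as phi         *)
(* satisfies the relations, see [plift_is_multiplicative].                    *)
Definition plift (x : presented) : G := eval_word (repr x).

Hypothesis phiR : forall s t, R s t -> eval_word s = eval_word t.

Lemma eval_word_eq u v : word_eq u v -> eval_word u = eval_word v.
Proof.
rewrite /eval_word.
elim=> {u v} [//|u v _ -> //|v u w _ -> //|u l v|u s t v /phiR st].
  rewrite !big_cat !big_cons /= /eval_letter /=.
  by case: l.2; rewrite /= ?mulKg ?mulVKg.
by move: st; rewrite /eval_word !big_cat /= => ->.
Qed.

Lemma plift_class u : plift (word_class u) = eval_word u.
Proof. exact/eval_word_eq/repr_word_class. Qed.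

Lemma plift_is_multiplicative : {morph plift : x y / x * y}.
Proof.
move=> x y; rewrite -[x]word_classK -[y]word_classK.
rewrite -[_ * _]word_class_cat !plift_class /eval_word big_cat //.
Qed.

Lemma plift_pgen t : plift (pgen t) = phi t.
Proof. by rewrite plift_class /eval_word big_seq1. Qed.

End Lift.

End Presentation.

Arguments presented : clear implicits.

Definition free_group (n : nat) : groupType := presented 'I_n (fun _ _ => False).

(* w(g_1, ..., g_n) for w in the free group F_n *)
Definition free_eval (n : nat) (G : groupType) (g : 'I_n -> G)
  (w : free_group n) : G := plift g w.

Lemma free_eval_is_multiplicative n (G : groupType) (g : 'I_n -> G) :
  {morph free_eval g : x y / x * y}.
Proof. exact: plift_is_multiplicative. Qed.

Lemma free_eval_gen n (G : groupType) (g : 'I_n -> G) i :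
  free_eval g (pgen _ i) = g i.
Proof. exact: plift_pgen. Qed.

Section FreeProduct.
Variables (I : choiceType) (H : I -> groupType).

(* The free product is presented by the disjoint union of the factors, with   *)
(* their multiplication tables as relations.                                  *)
Inductive freeprod_rel : word {i : I & H i} -> word {i : I & H i} -> Prop :=
| FreeprodRel i (a b : H i) :
    freeprod_rel [:: (Tagged H a, false); (Tagged H b, false)]
                 [:: (Tagged H (a * b), false)].

Definition freeprod : groupType := presented {i : I & H i} freeprod_rel.

Definition freeprod_in (i : I) (a : H i) : freeprod := pgen _ (Tagged H a).

Definition freeprod_lift (G : groupType) (phi : forall i, H i -> G)
  (x : freeprod) : G := plift (fun l => phi (tag l) (tagged l)) x.

Lemma freeprod_in_is_multiplicative i : {morph @freeprod_in i : a b / a * b}.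
Proof.
move=> a b; rewrite /freeprod_in /pgen -[RHS]word_class_cat; apply/word_classP.
exact: WordSym (@WordRel _ _ [::] _ _ [::] (FreeprodRel a b)).
Qed.

Section Lift.
Variables (G : groupType) (phi : forall i, H i -> G).
Hypothesis phiM : forall i, {morph @phi i : a b / a * b}.

Fact freeprod_lift_rel s t : freeprod_rel s t ->
  eval_word (fun l => phi (tagged l)) s =
  eval_word (fun l => phi (tagged l)) t.
Proof.
case=> i a b.
by rewrite /eval_word !big_cons !big_nil !mulg1 /eval_letter /= phiM.
Qed.

Lemma freeprod_lift_is_multiplicative :
  {morph freeprod_lift (@phi) : x y / x * y}.
Proof. exact/plift_is_multiplicative/freeprod_lift_rel. Qed.

Lemma freeprod_lift_in i (a : H i) : freeprod_lift (@phi) (freeprod_in a) = phi a.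
Proof. by rewrite /freeprod_lift plift_pgen //; exact: freeprod_lift_rel. Qed.

End Lift.
End FreeProduct.

Arguments freeprod_in {I} H i a.

Definition isomorphic (G K : groupType) : Prop :=
  exists f : {multiplicative G -> K}, bijective f.

(* 'I_2 carries MathComp's group structure of Z/2. *)
Definition Dinfty : groupType := freeprod (fun _ : bool => 'I_2 : groupType).

Definition satisfies_law (G : groupType) (r : nat) (w : free_group r) : Prop :=
  forall g : 'I_r -> G, free_eval g w = 1.

Definition satisfies_nontrivial_law (G : groupType) : Prop :=
  exists (r : nat) (w : free_group r), w <> 1 /\ satisfies_law G w.

(* The group F_n * H of equations in n unknowns with coefficients in H. *)
Definition coef_factor (n : nat) (H : groupType) (b : bool) : groupType :=
  if b then H else free_group n.

Definition coef_group (n : nat) (H : groupType) : groupType :=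
  freeprod (coef_factor n H).

(* w(g_1, ..., g_n, H) for w in F_n * H, with H sent to G along f *)
Definition coef_eval (n : nat) (H G : groupType) (f : H -> G) (g : 'I_n -> G)
  : coef_group n H -> G :=
  freeprod_lift (fun b : bool =>
    if b return coef_factor n H b -> G then f else free_eval g).

Lemma coef_eval_is_multiplicative n (H G : groupType)
    (f : {multiplicative H -> G}) (g : 'I_n -> G) :
  {morph coef_eval f g : x y / x * y}.
Proof.
apply: freeprod_lift_is_multiplicative => -[]; first exact: gmulfM.
exact: free_eval_is_multiplicative.
Qed.

Lemma coef_eval_unknown n (H G : groupType)
    (f : {multiplicative H -> G}) (g : 'I_n -> G) (i : 'I_n) :
  coef_eval f g (freeprod_in (coef_factor n H) false (pgen _ i)) = g i.
Proof.
rewrite [LHS]freeprod_lift_in; first exact: free_eval_gen.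
by case; [exact: gmulfM | exact: free_eval_is_multiplicative].
Qed.

Lemma coef_eval_const n (H G : groupType)
    (f : {multiplicative H -> G}) (g : 'I_n -> G) (h : H) :
  coef_eval f g (freeprod_in (coef_factor n H) true h) = f h.
Proof.
rewrite [LHS]freeprod_lift_in //.
by case; [exact: gmulfM | exact: free_eval_is_multiplicative].
Qed.

(* A subgroup H of G is given by its inclusion, an injective homomorphism     *)
(* f : H -> G; "a solution in H" is a solution in G of the form f \o h.       *)
Definition verbally_closed (H G : groupType) (f : {multiplicative H -> G})
    : Prop :=
  forall (n : nat) (w : free_group n) (h : H),
    (exists g : 'I_n -> G, free_eval g w = f h) ->
    exists k : 'I_n -> H, free_eval (f \o k) w = f h.

Definition algebraically_closed (H G : groupType) (f : {multiplicative H -> G})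
    : Prop :=
  forall (n m : nat) (w : 'I_m -> coef_group n H),
    (exists g : 'I_n -> G, forall j, coef_eval f g (w j) = 1) ->
    exists k : 'I_n -> H, forall j, coef_eval f (f \o k) (w j) = 1.

Definition strongly_verbally_closed (H : groupType) : Prop :=
  forall (G : groupType) (f : {multiplicative H -> G}),
    injective f -> verbally_closed f -> algebraically_closed f.

(* Main.v *)
(* On a free product the syllable length defines a tree-like (0-hyperbolic)
   metric, and every nontrivial element of the kernel of the map onto the direct
   product of the factors is hyperbolic.  A word u that is a law in every factor
   takes all its values in that kernel, under every substitution.  Products
   a ^ p * b ^ q of powers of noncommuting hyperbolic elements of equal
   translation length, with p large compared to q, determine a and b up to a
   common conjugation among all such products.  Iterating this gives, for every
   tuple t of the free product, a test word w(x, z): the equation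
   w(x, z) = w(t, s) forces x to be conjugate to t.  A free subgroup supplies s;
   it exists because the free product is not infinite dihedral.
   A finite system is then encoded in one coefficient-free equation: in w, the
   entries of t are the constants of the system, turned into unknowns, followed by
   its left-hand sides, whose value is 1.  A solution of this equation in the
   subgroup is, after conjugation, a solution of the system. *)

From HB Require Import structures.
Require Import Defs.
From Stdlib Require Import ZArith Lia.
From mathcomp Require Import all_boot zmodp boolp.

Set Implicit Arguments.
Unset Strict Implicit.
Unset Printing Implicit Defensive.
Local Open Scope group_scope.

(** The obstacle is that a solution of the test equation is an arbitrary substitution [f], of which
    a single value is known. Three devices make the geometry apply to it. Axes exist only for
    hyperbolic elements, so the unknown bases must lie in a normal subgroup free of elliptic
    elements. Rigidity needs bases of equal translation length, so the second base is always a
    conjugate of the first, in the word itself and hence under every [f]. Finally, a product of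
    powers reveals a conjugator only modulo the centralizer of its base: bases are therefore made to
    generate their own centralizers, and high powers serve as conjugators, because a root can be
    recovered from a power perturbed by such a centralizer. An entry of the tuple is recognised by
    its conjugates of two non-commuting elements, whose common centralizer is trivial. *)

Ltac gsimp :=
  rewrite ?(invgM, invgK, invg1, mulgA, mulgK, mulgVK, mulKg, mulVKg, mulVg, mulgV,
            mul1g, mulg1).

(** * Geometry of a group with a 0-hyperbolic length *)

Section IntegerPower.
Variable G : groupType.
Implicit Types (g x : G) (m n : Z).

Definition zpow g n : G :=
  match n with
  | Z0 => 1
  | Zpos p => g ^+ Pos.to_nat p
  | Zneg p => g ^- Pos.to_nat p
  end.

Lemma zpow1 g : zpow g 1 = g. Proof. by []. Qed.

Lemma zpowN1 g : zpow g (- 1) = g^-1. Proof. by []. Qed.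

Lemma zpow_nat g (n : nat) : zpow g (Z.of_nat n) = g ^+ n.
Proof. by case: n => [//|n] /=; rewrite SuccNat2Pos.id_succ. Qed.

Lemma zpowN g n : zpow g (- n) = (zpow g n)^-1.
Proof. by case: n => [|p|p] /=; rewrite ?invg1 ?invgK. Qed.

Lemma zpowS g n : zpow g (Z.succ n) = zpow g n * g.
Proof.
have [n_ge0|n_lt0] := Z_le_gt_dec 0 n.
  rewrite -(Z2Nat.id n) // -Nat2Z.inj_succ !zpow_nat; exact: expgSr.
pose k := Z.to_nat (- n - 1).
have -> : Z.succ n = Z.opp (Z.of_nat k) by lia.
have -> : n = Z.opp (Z.of_nat k.+1) by lia.
by rewrite !zpowN !zpow_nat expgS invgM mulgVK.
Qed.

Lemma zpowD g m n : zpow g (m + n) = zpow g m * zpow g n.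
Proof.
elim/Z.peano_ind: n => [|n IHn|n IHn]; first by rewrite Z.add_0_r mulg1.
  by rewrite Z.add_succ_r !zpowS IHn mulgA.
apply: (mulIg g); rewrite -zpowS Z.add_pred_r Z.succ_pred IHn -mulgA -zpowS.
by rewrite Z.succ_pred.
Qed.

Lemma zpowM g m n : zpow g (m * n) = zpow (zpow g m) n.
Proof.
elim/Z.peano_ind: n => [|n IHn|n IHn]; first by rewrite Z.mul_0_r.
  by rewrite Z.mul_succ_r zpowD zpowS IHn.
apply: (mulIg (zpow g m)); rewrite -zpowS -zpowD Z.succ_pred -IHn.
by congr (zpow g _); lia.
Qed.

Lemma zpow1g n : zpow 1 n = 1 :> G.
Proof.
by elim/Z.peano_ind: n => [//|n IHn|n IHn]; [rewrite zpowS IHn mulg1|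
  apply: (mulIg 1); rewrite -zpowS Z.succ_pred IHn mulg1].
Qed.

Lemma zpowVg g n : zpow g^-1 n = zpow g (- n).
Proof. by rewrite -zpowN1 -zpowM; congr zpow; lia. Qed.

Lemma zpowJ c g n : zpow (c * g * c^-1) n = c * zpow g n * c^-1.
Proof.
elim/Z.peano_ind: n => [|n IHn|n IHn]; first by rewrite /= mulg1 mulgV.
  by rewrite !zpowS IHn; gsimp.
apply: (mulIg (c * g * c^-1)); rewrite -zpowS Z.succ_pred IHn; gsimp.
by rewrite -(mulgA c (zpow g (Z.pred n))) -zpowS Z.succ_pred.
Qed.

Lemma commute_zpow x g n : commute x g -> commute x (zpow g n).
Proof.
move=> cxg; elim/Z.peano_ind: n => [|n IHn|n IHn]; first exact: commute1.
  by rewrite zpowS; apply: commuteM.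
have -> : zpow g (Z.pred n) = zpow g n * g^-1.
  by apply: (mulIg g); rewrite -zpowS Z.succ_pred mulgVK.
by apply: commuteM => //; apply: commuteV.
Qed.

Lemma commuteJP (x y : G) : commute x y <-> x * y * x^-1 = y.
Proof.
by split=> [-> | E]; [rewrite mulgK | rewrite /commute -{2}E mulgVK].
Qed.

Lemma commuteJ c (x y : G) :
  commute x y -> commute (c * x * c^-1) (c * y * c^-1).
Proof. by rewrite /commute => E; gsimp; rewrite -!(mulgA c) E. Qed.

Lemma commuteJ_inv c (x y : G) :
  commute (c * x * c^-1) (c * y * c^-1) -> commute x y.
Proof. by move/(@commuteJ c^-1); gsimp. Qed.

End IntegerPower.

Lemma ex_minZ (T : Type) (P : T -> Prop) (f : T -> Z) :
  (forall t, (0 <= f t)%Z) -> (exists t, P t) ->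
  exists2 t, P t & forall t', P t' -> (f t <= f t')%Z.
Proof.
move=> f_ge0 [t0 Pt0].
have ex : exists n, `[< exists2 t, P t & f t = Z.of_nat n >].
  by exists (Z.to_nat (f t0)); apply/asboolP; exists t0 => //; have := f_ge0 t0; lia.
case: (ex_minnP ex) => n /asboolP[t Pt ft] n_min.
exists t => // t' Pt'; have ft'_ge0 := f_ge0 t'.
have /leP : n <= Z.to_nat (f t').
  by apply: n_min; apply/asboolP; exists t' => //; lia.
rewrite ft; lia.
Qed.

Unset Implicit Arguments.

(** * Distances, axes and projections in a tree *)

Section Geometry.
Variables (G : groupType) (len : G -> Z).
Implicit Types (g h x y z w : G) (c k m n : Z).

Local Notation dist x y := (len (x^-1 * y)%g).
Local Open Scope Z_scope.

Hypothesis len_ge0 : forall x, 0 <= len x.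
Hypothesis len1 : len 1%g = 0.
Hypothesis len0_eq1 : forall x, len x = 0 -> x = 1%g.
Hypothesis lenV : forall x, len (x^-1)%g = len x.
Hypothesis len_four_point : forall x y z w,
  dist x y + dist z w <= Z.max (dist x z + dist y w) (dist x w + dist y z).

Lemma distC x y : dist x y = dist y x.
Proof. by rewrite -lenV invgM invgK. Qed.

Lemma distxx x : dist x x = 0. Proof. by rewrite mulVg. Qed.

Lemma dist0_eq x y : dist x y = 0 -> x = y.
Proof. by move/len0_eq1/mulg1_eq; rewrite invgK. Qed.

Lemma dist_tri x z y : dist x y <= dist x z + dist z y.
Proof.
have := len_four_point x y z z; have := len_ge0 (x^-1 * y)%g.
rewrite distxx (distC y z); lia.
Qed.

Lemma distMl g x y : dist (g * x)%g (g * y)%g = dist x y.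
Proof. by congr len; rewrite invgM -mulgA mulKg. Qed.

Lemma dist_zpow g m n x y :
  dist (zpow g m * x)%g (zpow g n * y)%g = dist x (zpow g (n - m) * y)%g.
Proof.
by rewrite {1}(_ : n = m + (n - m)); [rewrite zpowD -mulgA distMl | lia].
Qed.

Lemma dist_btw_uniq x y z w :
  dist x z + dist z y = dist x y -> dist x w + dist w y = dist x y ->
  dist x z = dist x w -> z = w.
Proof.
move=> zP wP zw; apply: dist0_eq; have := len_four_point x y z w.
have := len_ge0 (z^-1 * w)%g; rewrite (distC y w) (distC y z); lia.
Qed.

(** For [g <> 1] this puts [x] on the axis of [g]: the path from [x] over [g * x] to [g * g * x]
    does not backtrack. *)
Definition axial g x := dist x (g * g * x)%g = 2 * dist x (g * x)%g.

Definition hyp g := g <> 1%g /\ exists x, axial g x.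

(* The translation length of a hyperbolic [g]: there, the difference
   [dist x (g * g * x) - dist x (g * x)] does not depend on [x]. *)
Definition trl g := len (g * g)%g - len g.

Lemma dist_move_gt0 g x : g <> 1%g -> 0 < dist x (g * x)%g.
Proof.
move=> g_neq1; have := len_ge0 (x^-1 * (g * x))%g.
suff : dist x (g * x)%g <> 0 by lia.
by move=> /dist0_eq E; apply: g_neq1; apply: (mulIg x); rewrite mul1g.
Qed.

(** Local geodesics are global: steps have positive length, so the four-point condition on [x] and
    three consecutive points carries the equality one step further. *)
Lemma axial_dist_nat g x (n : nat) : g <> 1%g -> axial g x ->
  dist x (zpow g (Z.of_nat n) * x)%g = Z.of_nat n * dist x (g * x)%g.
Proof.
move=> g_neq1 gx; have l_gt0 := dist_move_gt0 g x g_neq1.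
elim: n {-2}n (leqnn n) => [|N IHN] n.
  by rewrite leqn0 => /eqP ->; rewrite mul1g distxx.
rewrite leq_eqVlt => /orP[/eqP->|]; last by rewrite ltnS; apply: IHN.
case: N IHN => [|[|N]] IHN; first by rewrite zpow1; lia.
  by rewrite (zpowD g 1 1) zpow1 gx.
have h1 := IHN N.+1 (leqnSn _); have h2 := IHN N.+2 (leqnn _).
have := len_four_point x (zpow g (Z.of_nat N.+2) * x)%g (zpow g (Z.of_nat N.+1) * x)%g
         (zpow g (Z.of_nat N.+3) * x)%g.
rewrite distC in h1; rewrite (distC x) in h2; rewrite !dist_zpow (distC x) h2.
have -> : Z.of_nat N.+3 - Z.of_nat N.+1 = 1 + 1 by lia.
have -> : Z.of_nat N.+3 - Z.of_nat N.+2 = 1 by lia.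
have -> : Z.of_nat N.+1 - Z.of_nat N.+2 = - 1 by lia.
rewrite (zpowD g 1 1) zpow1 zpowN1 (distC x (zpow g (Z.of_nat N.+1) * x)%g) h1 gx.
have -> : dist x (g^-1 * x)%g = dist x (g * x)%g.
  by rewrite -(distMl g) mulVKg distC.
have := dist_tri x (zpow g (Z.of_nat N.+2) * x)%g (zpow g (Z.of_nat N.+3) * x)%g.
rewrite dist_zpow (distC x (zpow g (Z.of_nat N.+2) * x)%g) h2.
have -> : Z.of_nat N.+3 - Z.of_nat N.+2 = 1 by lia.
rewrite zpow1; nia.
Qed.

Lemma axial_dist g x n : g <> 1%g -> axial g x ->
  dist x (zpow g n * x)%g = Z.abs n * dist x (g * x)%g.
Proof.
move=> g_neq1 gx; have [n_ge0|n_lt0] := Z_le_gt_dec 0 n.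
  by rewrite -{1}(Z2Nat.id n) // axial_dist_nat // Z2Nat.id // Z.abs_eq.
have := dist_zpow g n 0 x x; rewrite mul1g Z.sub_0_l distC => ->.
have Nn_ge0 : 0 <= - n by lia.
by rewrite -{1}(Z2Nat.id (- n)) // axial_dist_nat // Z2Nat.id // -Z.abs_opp Z.abs_eq.
Qed.

(** The path from [y] to the axis enters it at the projection of [y]. Position [c] and distance [D]
    are doubled because the projection need not be an element of [G]. *)
Definition coordl l g x y c D :=
  forall n, 2 * dist y (zpow g n * x)%g = Z.abs (2 * n * l - c) + D.

(** Around an orbit point closest to [y] the distance grows by [l] per step. Only the first step
    towards the projection may gain less ([turn]); its defect yields [c] and [D]. *)
Lemma coordl_ex g x y : g <> 1%g -> axial g x ->
  exists c D, 0 <= D /\ coordl (dist x (g * x)%g) g x y c D.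
Proof.
move=> g_neq1 gx; set l := dist x (g * x)%g.
have l_gt0 : 0 < l by apply: dist_move_gt0.
have [n0 _ n0_min] := @ex_minZ _ (fun _ : Z => True) (fun n => dist y (zpow g n * x)%g)
  (fun n => len_ge0 _) (ex_intro _ 0 I).
pose p n := dist y (zpow g (n0 + n) * x)%g.
have pmin n : p 0 <= p n by rewrite /p Z.add_0_r; apply: n0_min.
have dp i j : dist (zpow g (n0 + i) * x)%g (zpow g (n0 + j) * x)%g = Z.abs (j - i) * l.
  by rewrite dist_zpow axial_dist //; congr (Z.abs _ * _); lia.
have p_pos k : 1 <= k -> p k = p 1 + (k - 1) * l.
  move=> k1; have := len_four_point y (zpow g (n0 + 1) * x)%g (zpow g (n0 + 0) * x)%g
     (zpow g (n0 + k) * x)%g.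
  have := dist_tri y (zpow g (n0 + 1) * x)%g (zpow g (n0 + k) * x)%g.
  rewrite !dp -/(p 1) -/(p 0) -/(p k); have := pmin 1; nia.
have p_neg k : 1 <= k -> p (- k) = p (- 1) + (k - 1) * l.
  move=> k1; have := len_four_point y (zpow g (n0 + - 1) * x)%g (zpow g (n0 + 0) * x)%g
     (zpow g (n0 + - k) * x)%g.
  have := dist_tri y (zpow g (n0 + - 1) * x)%g (zpow g (n0 + - k) * x)%g.
  rewrite !dp -/(p (- 1)) -/(p 0) -/(p (- k)); have := pmin (- 1); nia.
have turn : p 1 = p 0 + l \/ p (- 1) = p 0 + l.
  have := len_four_point (zpow g (n0 + 1) * x)%g (zpow g (n0 + - 1) * x)%g y
     (zpow g (n0 + 0) * x)%g.
  have := dist_tri y (zpow g (n0 + 0) * x)%g (zpow g (n0 + 1) * x)%g.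
  have := dist_tri y (zpow g (n0 + 0) * x)%g (zpow g (n0 + - 1) * x)%g.
  rewrite !dp (distC _ y) (distC _ y) -/(p 1) -/(p 0) -/(p (- 1)); lia.
have tr1 : l <= p 0 + p 1.
  have := dist_tri (zpow g (n0 + 0) * x)%g y (zpow g (n0 + 1) * x)%g.
  rewrite !dp (distC _ y) -/(p 1) -/(p 0); lia.
have trN1 : l <= p 0 + p (- 1).
  have := dist_tri (zpow g (n0 + 0) * x)%g y (zpow g (n0 + - 1) * x)%g.
  rewrite !dp (distC _ y) -/(p (- 1)) -/(p 0); lia.
have pE n : dist y (zpow g n * x)%g = p (n - n0).
  by rewrite /p; congr (dist _ (zpow _ _ * _)%g); lia.
have up1 : p 1 <= p 0 + l.
  have := dist_tri y (zpow g (n0 + 0) * x)%g (zpow g (n0 + 1) * x)%g.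
  by rewrite dp -/(p 1) -/(p 0); lia.
have upN1 : p (- 1) <= p 0 + l.
  have := dist_tri y (zpow g (n0 + 0) * x)%g (zpow g (n0 + - 1) * x)%g.
  by rewrite dp -/(p (- 1)) -/(p 0); lia.
have m1 := pmin 1; have mN1 := pmin (- 1).
case: turn => E.
  exists (2 * n0 * l - (p 0 + l - p (- 1))), (p 0 - l + p (- 1)).
  split=> [|n]; first lia.
  rewrite pE; set k := n - n0; have -> : n = n0 + k by rewrite /k; lia.
  clearbody k; have [k_lt0|[->|k_gt0]] : k <= - 1 \/ k = 0 \/ 1 <= k by lia.
  - by rewrite -{1}(Z.opp_involutive k) p_neg; nia.
  - lia.
  - by rewrite p_pos //; nia.
exists (2 * n0 * l + (p 0 + l - p 1)), (p 0 - l + p 1).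
split=> [|n]; first lia.
rewrite pE; set k := n - n0; have -> : n = n0 + k by rewrite /k; lia.
clearbody k; have [k_lt0|[->|k_gt0]] : k <= - 1 \/ k = 0 \/ 1 <= k by lia.
- by rewrite -{1}(Z.opp_involutive k) p_neg; nia.
- lia.
- by rewrite p_pos //; nia.
Qed.

(** Orbit points beyond both projections, one at each end, witness the distance. With equal
    projections only the inequality remains, since the paths to the axis may share a part. *)
Lemma coordl_dist l g x y1 y2 c1 c2 D1 D2 : 0 < l -> 
  (forall n, dist x (zpow g n * x)%g = Z.abs n * l) ->
  coordl l g x y1 c1 D1 -> coordl l g x y2 c2 D2 ->
  2 * dist y1 y2 <= Z.abs (c1 - c2) + D1 + D2 /\
  (c1 <> c2 -> 2 * dist y1 y2 = Z.abs (c1 - c2) + D1 + D2).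
Proof.
move=> l_gt0 gx y1P y2P; pose N := Z.abs c1 + Z.abs c2 + 1.
have Nl : N <= N * l by nia.
set X := (zpow g N * x)%g; set Y := (zpow g (- N) * x)%g.
have XY : dist X Y = 2 * (N * l) by rewrite dist_zpow gx; lia.
have := y1P N; have := y1P (- N); have := y2P N; have := y2P (- N).
rewrite -/X -/Y.
have := len_four_point y1 y2 X Y; have := len_four_point y1 X y2 Y.
have := len_four_point y1 Y y2 X.
rewrite (distC X y2) (distC Y y2) (distC Y X) XY.
have -> : 2 * N * l = 2 * (N * l) by lia.
have -> : 2 * - N * l = - (2 * (N * l)) by lia.
clearbody X Y; move: (N * l) Nl XY => K Nl XY; rewrite /N in Nl; lia.
Qed.

Lemma coordl_zpow l g x y c D m :
  coordl l g x y c D -> coordl l g x (zpow g m * y)%g (c + 2 * m * l) D.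
Proof. by move=> yP n; rewrite dist_zpow yP; congr (Z.abs _ + _); lia. Qed.

Lemma axial_orbit_dist g x y : g <> 1%g -> axial g x -> exists2 D, 0 <= D &
  forall n, n <> 0 -> dist y (zpow g n * y)%g = Z.abs n * dist x (g * x)%g + D.
Proof.
move=> g_neq1 gx; have l_gt0 := dist_move_gt0 g x g_neq1.
have [c [D [D_ge0 yP]]] := coordl_ex g x y g_neq1 gx.
exists D => // n n_neq0; have ynP := coordl_zpow _ _ _ _ _ _ n yP.
have [_] := coordl_dist _ _ _ _ _ _ _ _ _ l_gt0
  (fun n => axial_dist g x n g_neq1 gx) yP ynP; nia.
Qed.

Lemma trl_axial g x : g <> 1%g -> axial g x -> trl g = dist x (g * x)%g.
Proof.
move=> g_neq1 gx; have [D _ DP] := axial_orbit_dist g x 1%g g_neq1 gx.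
have := DP 2 ltac:(lia); have := DP 1 ltac:(lia).
by rewrite (zpowD g 1 1) zpow1 !mulg1 invg1 !mul1g /trl; lia.
Qed.

(* Twice the distance from [y] to the axis of [g]. *)
Definition axdist g y := dist y (g * y)%g - trl g.

Lemma trl_gt0 g : hyp g -> 0 < trl g.
Proof.
by case=> g_neq1 [x gx]; rewrite (trl_axial g x) //; apply: dist_move_gt0.
Qed.

Lemma hyp_dist g y n : hyp g -> n <> 0 ->
  dist y (zpow g n * y)%g = Z.abs n * trl g + axdist g y.
Proof.
case=> g_neq1 [x gx] n_neq0; have [D _ DP] := axial_orbit_dist g x y g_neq1 gx.
have := DP 1 ltac:(lia); rewrite zpow1 /axdist (trl_axial g x) // DP //; lia.
Qed.

Lemma axdist_ge0 g y : hyp g -> 0 <= axdist g y.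
Proof.
case=> g_neq1 [x gx]; have [D D_ge0 DP] := axial_orbit_dist g x y g_neq1 gx.
have := DP 1 ltac:(lia); rewrite zpow1 /axdist (trl_axial g x) //; lia.
Qed.

Lemma axialP g y : hyp g -> axial g y <-> axdist g y = 0.
Proof.
move=> gH; have := hyp_dist g y 2 gH ltac:(lia); have := hyp_dist g y 1 gH ltac:(lia).
rewrite (zpowD g 1 1) zpow1 /axial; lia.
Qed.

Lemma axdist_zpow g n y : axdist g (zpow g n * y)%g = axdist g y.
Proof.
rewrite /axdist; congr (_ - _).
by rewrite (mulgA g) (commute_zpow n (commute_refl g)) -(mulgA _ g) distMl.
Qed.

Lemma axial_zpow g n y : hyp g -> axial g y -> axial g (zpow g n * y)%g.
Proof. by move=> gH /(axialP _ _ gH) gy; apply/(axialP _ _ gH); rewrite axdist_zpow. Qed.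

Lemma axial_dist_zpow g y n : hyp g -> axial g y ->
  dist y (zpow g n * y)%g = Z.abs n * trl g.
Proof. by move=> [g_neq1 _] gy; rewrite axial_dist // (trl_axial g y). Qed.

(* [c] is twice the position on the axis of [g] of the projection of [y]. *)
Definition coord g x y c :=
  forall n, 2 * dist y (zpow g n * x)%g = Z.abs (2 * n * trl g - c) + axdist g y.

Lemma coord_ex g x y : hyp g -> axial g x -> exists c, coord g x y c.
Proof.
move=> gH gx; have [c [D [D_ge0 yP]]] := coordl_ex g x y gH.1 gx.
rewrite -trl_axial // in yP; last exact: gH.1.
exists c; suff E : axdist g y = D by move=> n; rewrite E.

have ygP := coordl_zpow _ _ _ _ _ _ 1 yP.
have [_] := coordl_dist _ _ _ _ _ _ _ _ _ (trl_gt0 g gH)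
  (fun n => axial_dist_zpow g x n gH gx) yP ygP.
by rewrite zpow1 /axdist; have := trl_gt0 g gH; lia.
Qed.

Lemma coord_dist g x y1 y2 c1 c2 : hyp g -> axial g x ->
  coord g x y1 c1 -> coord g x y2 c2 ->
  2 * dist y1 y2 <= Z.abs (c1 - c2) + axdist g y1 + axdist g y2 /\
  (c1 <> c2 -> 2 * dist y1 y2 = Z.abs (c1 - c2) + axdist g y1 + axdist g y2).
Proof.
move=> gH gx; apply: coordl_dist => [|n]; first exact: trl_gt0.
exact: axial_dist_zpow.
Qed.

(** In a tree a path approaches the axis at full speed, follows it or turns away, and recedes at
    full speed. Far points [X] and [Y] of the axis reduce this to the four-point condition. *)
Lemma axdist_btw g y1 y2 z : hyp g -> dist y1 z + dist z y2 = dist y1 y2 ->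
  axdist g z = 0 \/ axdist g z <= axdist g y1 - 2 * dist y1 z \/
  axdist g z <= axdist g y2 - 2 * dist z y2.
Proof.
move=> gH btw; have l_gt0 := trl_gt0 g gH; have := gH; case=> g_neq1 [x gx].
have [c1 y1P] := coord_ex g x y1 gH gx; have [c2 y2P] := coord_ex g x y2 gH gx.
have [c zP] := coord_ex g x z gH gx.
have [d12 d12E] := coord_dist g x y1 y2 c1 c2 gH gx y1P y2P.
pose N := Z.abs c1 + Z.abs c2 + Z.abs c + 1.
have Nl : N <= N * trl g by nia.
set X := (zpow g N * x)%g; set Y := (zpow g (- N) * x)%g.
have E1 : 2 * N * trl g = 2 * (N * trl g) by lia.
have E2 : 2 * - N * trl g = - (2 * (N * trl g)) by lia.
have y1X := y1P N; have y1Y := y1P (- N); have y2X := y2P N; have y2Y := y2P (- N).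
have zX := zP N; have zY := zP (- N); rewrite -/X -/Y ?E1 ?E2 in y1X y1Y y2X y2Y zX zY.
have hX := len_four_point z X y1 y2; have hY := len_four_point z Y y1 y2.
rewrite (distC X y1) (distC X y2) (distC Y y1) (distC Y y2) (distC z y1) in hX hY.
have Dz_ge0 := axdist_ge0 g z gH.
clearbody X Y; move: (N * trl g) Nl y1X y1Y y2X y2Y zX zY => K Nl y1X y1Y y2X y2Y zX zY.
rewrite /N in Nl; clear y1P y2P zP E1 E2 N gx g_neq1.
move: hX hY d12E d12; have {}y1X : 2 * dist y1 X = 2 * K - c1 + axdist g y1 by lia.
have {}y2X : 2 * dist y2 X = 2 * K - c2 + axdist g y2 by lia.
have {}zX : 2 * dist z X = 2 * K - c + axdist g z by lia.
have {}y1Y : 2 * dist y1 Y = 2 * K + c1 + axdist g y1 by lia.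
have {}y2Y : 2 * dist y2 Y = 2 * K + c2 + axdist g y2 by lia.
have {}zY : 2 * dist z Y = 2 * K + c + axdist g z by lia.
clear Nl => hX hY d12E d12.
have {}hX : axdist g z - c <= axdist g y2 - c2 - 2 * dist z y2 \/
  axdist g z - c <= axdist g y1 - c1 - 2 * dist y1 z by lia.
have {}hY : axdist g z + c <= axdist g y2 + c2 - 2 * dist z y2 \/
  axdist g z + c <= axdist g y1 + c1 - 2 * dist y1 z by lia.
clear y1X y1Y y2X y2Y zX zY K.
have [c12|/d12E {}d12E] := Z.eq_dec c1 c2; first by lia.
by case: hX hY => hX [hY|hY]; lia.
Qed.

Lemma hypJ (c : G) g : hyp g -> hyp (c * g * c^-1)%g.
Proof.
case=> g_neq1 [x gx]; split.
  by move=> E; apply: g_neq1; apply: (mulgI c); apply: (mulIg c^-1)%g; rewrite E; gsimp.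
by exists (c * x)%g; move: gx; rewrite /axial; gsimp.
Qed.

Lemma axdistJ (c : G) g y : hyp g -> trl (c * g * c^-1)%g = trl g /\
  axdist (c * g * c^-1)%g (c * y)%g = axdist g y.
Proof.
move=> gH; have cgH := hypJ c g gH.
have E : trl (c * g * c^-1)%g = trl g.
  have [g_neq1 [x gx]] := gH.
  rewrite (trl_axial g x) // (trl_axial _ (c * x)%g); last 2 first.
  - exact: cgH.1.
  - by move: gx; rewrite /axial; gsimp.
  by gsimp.
by split=> //; rewrite /axdist E; gsimp.
Qed.

Lemma trlJ (c : G) g : hyp g -> trl (c * g * c^-1)%g = trl g.
Proof. by move=> gH; have [] := axdistJ c g 1%g gH. Qed.

Lemma hyp_zpow g n : hyp g -> n <> 0 ->
  hyp (zpow g n) /\ trl (zpow g n) = Z.abs n * trl g /\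
  forall y, axdist (zpow g n) y = axdist g y.
Proof.
move=> gH n_neq0; have [g_neq1 [x gx]] := gH; have l_gt0 := trl_gt0 g gH.
have gn_neq1 : zpow g n <> 1%g.
  move=> E; have := hyp_dist g x n gH n_neq0.
  by rewrite E mul1g distxx ((axialP g x gH).1 gx); nia.
have gnx : axial (zpow g n) x.
  by rewrite /axial -zpowD !axial_dist_zpow //; nia.
have E : trl (zpow g n) = Z.abs n * trl g.
  by rewrite (trl_axial _ x) // axial_dist_zpow.
by split; [split; last exists x | split=> // y; rewrite /axdist E hyp_dist //; rewrite /axdist; lia].
Qed.

(* Position of [y] on the axis of [g], measured from the point [x] of that axis. *)
Definition pos g x y k := forall n, dist y (zpow g n * x)%g = Z.abs (n * trl g - k).

Lemma pos_ex g x y : hyp g -> axial g x -> axial g y -> exists k, pos g x y k.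
Proof.
move=> gH gx /(axialP _ _ gH) gy; have [c yP] := coord_ex g x y gH gx.
have := yP 0; rewrite gy => E0.
exists (c / 2); have cE : c = 2 * (c / 2).
  have : c mod 2 = 0.
    by have := Z.mod_pos_bound c 2; have := Z.div_mod c 2; lia.
  by have := Z.div_mod c 2; lia.
by move=> n; have := yP n; rewrite gy {1}cE; lia.
Qed.

Lemma pos_self g x : hyp g -> axial g x -> pos g x x 0.
Proof. by move=> gH gx n; rewrite axial_dist_zpow //; have := trl_gt0 g gH; nia. Qed.

Lemma pos_dist g x y z k m : hyp g -> axial g x -> pos g x y k -> pos g x z m ->
  dist y z = Z.abs (k - m).
Proof.
move=> gH gx yP zP; have l_gt0 := trl_gt0 g gH.
pose N := Z.abs k + Z.abs m + 1; have Nl : N <= N * trl g by nia.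
have := yP N; have := zP N; have := yP (- N); have := zP (- N).
have -> : - N * trl g = - (N * trl g) by lia.
set X := (zpow g N * x)%g; set Y := (zpow g (- N) * x)%g.
have XY : dist X Y = 2 * (N * trl g) by rewrite dist_zpow axial_dist_zpow //; nia.
have := len_four_point y z X Y; have := dist_tri y z X; have := dist_tri z y X.
rewrite XY (distC z y); clearbody X Y; move: (N * trl g) Nl XY => K Nl XY.
rewrite /N in Nl; lia.
Qed.

Lemma pos_inj g x y z k : hyp g -> axial g x -> pos g x y k -> pos g x z k -> y = z.
Proof.
move=> gH gx yP zP; apply: dist0_eq; rewrite (pos_dist g x y z k k) //; lia.
Qed.

Lemma pos_zpow g x y k n : pos g x y k -> pos g x (zpow g n * y)%g (k + n * trl g).
Proof. by move=> yP m; rewrite dist_zpow yP; congr Z.abs; lia. Qed.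

Lemma pos_axial g x y k : hyp g -> axial g x -> pos g x y k -> axial g y.
Proof.
move=> gH gx yP; apply/axialP => //; rewrite /axdist -{1}[g]zpow1.
rewrite (pos_dist g x y (zpow g 1 * y)%g k (k + 1 * trl g)) //; last exact: pos_zpow.
by have := trl_gt0 g gH; lia.
Qed.

Lemma pos_trans g x y z k m : hyp g -> axial g x ->
  pos g x y k -> pos g y z m -> pos g x z (k + m).
Proof.
move=> gH gx yP zP; have l_gt0 := trl_gt0 g gH.
have gy := pos_axial g x y k gH gx yP; have gz := pos_axial g y z m gH gy zP.
have [j zP'] := pos_ex g x z gH gx gz; suff -> : k + m = j by [].
have E n : Z.abs (n * trl g - m) = Z.abs (j - k - n * trl g).
  rewrite -zP (pos_dist g x z (zpow g n * y)%g j (k + n * trl g)) //.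
    by congr Z.abs; lia.
  exact: pos_zpow.
(* [n = 0] fixes [j - k] up to sign, a large [n] fixes the sign. *)
have := E 0; have := E (Z.abs j + Z.abs k + Z.abs m + 1); nia.
Qed.

Lemma pos_btw g x y z w k m : hyp g -> axial g x -> pos g x y k -> pos g x z m ->
  dist y w + dist w z = dist y z ->
  exists2 j, pos g x w j & Z.min k m <= j <= Z.max k m.
Proof.
move=> gH gx yP zP btw.
have gy := (axialP g y gH).1 (pos_axial g x y k gH gx yP).
have gz := (axialP g z gH).1 (pos_axial g x z m gH gx zP).
have gw : axial g w.
  apply/axialP => //; have := axdist_btw g y z w gH btw; have := axdist_ge0 g w gH.
  have := len_ge0 (y^-1 * w)%g; have := len_ge0 (w^-1 * z)%g; lia.
have [j wP] := pos_ex g x w gH gx gw; exists j => //.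
have := pos_dist g x y z k m gH gx yP zP; have := pos_dist g x y w k j gH gx yP wP.
have := pos_dist g x w z j m gH gx wP zP; lia.
Qed.

(* If [h] translates two points of the axis of [g] along that axis by the same
   amount, it translates every point in between likewise. *)
Lemma pos_shift g x h u0 u1 w k0 k1 j s : hyp g -> axial g x ->
  pos g x u0 k0 -> pos g x u1 k1 -> pos g x (h * u0)%g (k0 + s) ->
  pos g x (h * u1)%g (k1 + s) -> pos g x w j -> k0 <= j <= k1 ->
  pos g x (h * w)%g (j + s).
Proof.
move=> gH gx u0P u1P hu0P hu1P wP jP.
have d01 := pos_dist g x u0 u1 k0 k1 gH gx u0P u1P.
have d0w := pos_dist g x u0 w k0 j gH gx u0P wP.
have dw1 := pos_dist g x w u1 j k1 gH gx wP u1P.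
have [] := pos_btw g x (h * u0)%g (h * u1)%g (h * w)%g (k0 + s) (k1 + s) gH gx hu0P hu1P.
  by rewrite !distMl; lia.
move=> i hwP iP; suff -> : j + s = i by [].
have := pos_dist g x (h * u0)%g (h * w)%g (k0 + s) i gH gx hu0P hwP.
by rewrite distMl; lia.
Qed.

(** * Elements commuting with a hyperbolic element *)

Lemma commute_pos a x b : hyp a -> axial a x -> commute b a ->
  exists t, forall y k, pos a x y k -> pos a x (b * y)%g (k + t).
Proof.
move=> aH ax cba; have bx : axial a (b * x)%g.
  apply/axialP => //; rewrite /axdist (mulgA a) -cba -(mulgA b) distMl.
  exact/(axialP a x aH).
have [t tP] := pos_ex a x (b * x)%g aH ax bx.
exists t => y k yP; rewrite Z.add_comm; apply: pos_trans tP _ => // n.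
by rewrite (mulgA (zpow a n)) -(commute_zpow n cba) -(mulgA b) distMl.
Qed.

(** Both act on the axis of [a] by translations, which commute; [G] acts freely on itself, so
    agreement at one point suffices. *)
Lemma commute_trans_hyp a b (c : G) : hyp a -> commute b a -> commute c a -> commute b c.
Proof.
move=> aH ba ca; have [_ [x ax]] := aH.
have [s sP] := commute_pos a x b aH ax ba; have [t tP] := commute_pos a x c aH ax ca.
apply: (mulIg x); rewrite -!mulgA.
have xP := pos_self a x aH ax; apply: (pos_inj a x _ _ (0 + t + s) aH ax).
  exact/sP/tP.
have -> : 0 + t + s = 0 + s + t by lia.
exact/tP/sP.
Qed.

Lemma commute_axial a x b : hyp a -> axial a x -> commute b a -> b <> 1%g ->
  hyp b /\ axial b x.
Proof.
move=> aH ax ba b_neq1; suff bx : axial b x by split=> //; split=> //; exists x.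
have [t tP] := commute_pos a x b aH ax ba; have xP := pos_self a x aH ax.
have bxP := tP _ _ xP; have bbxP := tP _ _ bxP; rewrite mulgA in bbxP.
rewrite /axial (pos_dist a x x (b * x)%g 0 (0 + t) aH ax xP bxP).
rewrite (pos_dist a x x (b * b * x)%g 0 (0 + t + t) aH ax xP bbxP); lia.
Qed.

Lemma commute_trl_eq a b : hyp a -> hyp b -> commute b a -> trl b = trl a ->
  b = a \/ b = a^-1%g.
Proof.
move=> aH bH ba E; have [_ [x ax]] := aH.
have [_ bx] := commute_axial a x b aH ax ba bH.1.
have [t tP] := commute_pos a x b aH ax ba; have xP := pos_self a x aH ax.
have bxP := tP _ _ xP.
have := pos_dist a x x (b * x)%g 0 (0 + t) aH ax xP bxP.
rewrite -(trl_axial b x) ?E //; last exact: bH.1.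
move=> tE; have [tE'|tE'] : t = 1 * trl a \/ t = - 1 * trl a by have := trl_gt0 a aH; lia.
  left; apply: (mulIg x); rewrite tE' in bxP.
  exact: (pos_inj a x _ _ _ aH ax bxP (pos_zpow a x x 0 1 xP)).
right; apply: (mulIg x); rewrite tE' in bxP.
exact: (pos_inj a x _ _ _ aH ax bxP (pos_zpow a x x 0 (- 1) xP)).
Qed.

Lemma commute_root a n b : hyp a -> n <> 0 -> commute b (zpow a n) -> commute b a.
Proof.
move=> aH n_neq0 ba; have [anH _] := hyp_zpow a n aH n_neq0.
exact: commute_trans_hyp anH ba (commute_zpow n (commute_refl a)).
Qed.

Lemma zpow_hyp_inj g h n : hyp g -> hyp h -> n <> 0 -> zpow g n = zpow h n -> g = h.
Proof.
move=> gH hH n_neq0 E.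
have [gnH [gnE _]] := hyp_zpow g n gH n_neq0; have [_ [hnE _]] := hyp_zpow h n hH n_neq0.
have hg : commute h g.
  by apply: (commute_root g n) => //; rewrite E; apply: commute_zpow.
have lE : trl h = trl g by rewrite E hnE in gnE; nia.
have [//|hE] := commute_trl_eq g h gH hH hg lE.
have [[]] := hyp_zpow g (2 * n) gH ltac:(lia).
case; rewrite (_ : 2 * n = n + n); last by lia.
by rewrite zpowD {2}E hE -zpowN1 -zpowM -zpowD (_ : n + -1 * n = 0) //; lia.
Qed.

(** A non-trivial [g] would be hyperbolic, as it commutes with [a], and elements commuting with a
    hyperbolic one commute with each other. *)
Lemma centralizer_pair a b g : hyp a -> ~ commute a b -> commute g a -> commute g b ->
  g = 1%g.
Proof.
move=> aH ab ga gb; case: (EM (g = 1%g)) => // g_neq1; case: ab.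
have [_ [x ax]] := aH; have [gH _] := commute_axial a x g aH ax ga g_neq1.
by apply: commute_trans_hyp gH _ _; apply: commute_sym.
Qed.

(** A commuting conjugate of [a] has the same translation length, so it is [a] or its inverse; then
    the square of [t] commutes with [a], hence so does [t]. *)
Lemma noncommute_conj a t : hyp a -> hyp t -> ~ commute t a ->
  ~ commute a (t * a * t^-1)%g.
Proof.
move=> aH tH ta /commute_sym ata; have H := hypJ t a aH.
have [E|E] := commute_trl_eq a _ aH H ata (trlJ t a aH).
  by apply: ta; apply/commuteJP.
apply/ta/commute_sym/(commute_root t 2 a tH); first by lia.
apply: commute_sym.
apply/commuteJP; rewrite (zpowD t 1 1) zpow1 invgM.
have -> : (t * t * a * (t^-1 * t^-1) = t * (t * a * t^-1) * t^-1)%g by gsimp.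
have -> : (t * (t * a * t^-1) * t^-1 = (t * a * t^-1)^-1)%g by rewrite {1}E; gsimp.
by rewrite E invgK.
Qed.

(** * Products of powers of two hyperbolic elements *)

Lemma corner_bound a b : hyp a -> hyp b -> trl a = trl b -> b <> a -> b <> a^-1%g ->
  exists2 x, axial a x & forall m n,
    dist x (zpow a m * x)%g + dist x (zpow b n * x)%g
      - dist (zpow a m * x)%g (zpow b n * x)%g < 4 * trl a.
Proof.
move=> aH bH lE b_a b_aV; have l_gt0 := trl_gt0 a aH.
(* A point of the axis of [a] nearest to that of [b]. If the two orbits of [x] ran together for two
   periods, [x] would lie on both axes, and one step of [a] and one of [b] would end at the same
   point; as the action is free, [b] would be [a] or its inverse. *)
have [x ax x_min] := @ex_minZ _ (axial a) (axdist b) (fun y => axdist_ge0 b y bH) aH.2.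
exists x => // m n; have [//|big] := Z_lt_ge_dec
  (dist x (zpow a m * x)%g + dist x (zpow b n * x)%g
      - dist (zpow a m * x)%g (zpow b n * x)%g) (4 * trl a).
exfalso.
have tri1 := dist_tri x (zpow a m * x)%g (zpow b n * x)%g.
have tri2 := dist_tri x (zpow b n * x)%g (zpow a m * x)%g.
rewrite (distC (zpow b n * x)%g (zpow a m * x)%g) in tri2.
have am := axial_dist_zpow a x m aH ax; have m_ge2 : 2 <= Z.abs m by nia.
have n_neq0 : n <> 0 by move=> E; rewrite E mul1g distxx in big tri1 tri2; lia.
pose e := Z.sgn m; have e1 : Z.abs e = 1 by rewrite /e; lia.
have xz : dist x (zpow a e * x)%g = trl a by rewrite axial_dist_zpow // e1; lia.
have zm : dist (zpow a e * x)%g (zpow a m * x)%g = Z.abs m * trl a - trl a.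
  by rewrite dist_zpow axial_dist_zpow // /e; nia.
have az : axial a (zpow a e * x)%g by apply: axial_zpow.
have Dz := x_min _ az.
have [z zE] : exists z, (zpow a e * x)%g = z by exists (zpow a e * x)%g.
rewrite zE in xz zm az Dz.
have btw : dist x z + dist z (zpow b n * x)%g = dist x (zpow b n * x)%g.
  have := len_four_point z (zpow b n * x)%g x (zpow a m * x)%g.
  have := dist_tri x z (zpow b n * x)%g.
  rewrite (distC z x) (distC (zpow b n * x)%g x) (distC (zpow b n * x)%g (zpow a m * x)%g).
  by lia.
have D0 := axdist_ge0 b x bH; have := axdist_btw b x (zpow b n * x)%g z bH btw.
rewrite axdist_zpow => Dx; have {}D0 : axdist b x = 0 by lia.
have bn := hyp_dist b x n bH n_neq0; rewrite D0 -lE in bn.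
pose f := Z.sgn n; have f1 : Z.abs f = 1 by rewrite /f; lia.
have xw : dist x (zpow b f * x)%g = trl a.
  by rewrite (hyp_dist b x f bH) ?D0 ?f1 -?lE; lia.
have wn : dist (zpow b f * x)%g (zpow b n * x)%g = Z.abs n * trl a - trl a.
  rewrite dist_zpow; have [E|E] := Z.eq_dec (n - f) 0.
    by rewrite E mul1g distxx (_ : Z.abs n = 1); lia.
  by rewrite (hyp_dist b x _ bH E) D0 -lE /f; nia.
have E : zpow a e = zpow b f.
  apply: (mulIg x); rewrite zE.
  by apply: (dist_btw_uniq x (zpow b n * x)%g); rewrite ?btw ?xw ?wn ?bn ?xz; lia.
have [eE|eE] : e = 1 \/ e = - 1 by lia.
all: have [fE|fE] : f = 1 \/ f = - 1 by lia.
all: rewrite eE fE ?zpow1 ?zpowN1 in E.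
- exact: b_a.
- by apply: b_aV; rewrite E invgK.
- by apply: b_aV.
- by apply: b_a; apply: invg_inj.
Qed.

(** [c] and [c'] are twice the backtracks at [u] and [v]; by the bound these do not meet inside the
    segment from [u] to [v], so they do not interact. *)
Lemma dist_step o u v w c c' : dist o v = dist o u + dist u v - c ->
  dist u w = dist u v + dist v w - c' -> c + c' < 2 * dist u v ->
  dist o w = dist o v + dist v w - c'.
Proof.
move=> ov uw cc; have := len_four_point o v u w; have := len_four_point o w u v.
rewrite (distC w v) (distC v u); rewrite (distC w u); lia.
Qed.

(* [mulgA] with the canonical structures that [lia] meets in the other distances. *)
Lemma mulA (x y z : G) : (x * (y * z) = x * y * z)%g. Proof. exact: mulgA. Qed.

Lemma dist_zpowl g m n x y :
  dist (zpow g m * x)%g (zpow g n * y)%g = dist (zpow g (m - n) * x)%g y.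
Proof. by rewrite distC dist_zpow distC. Qed.

(* The axes of [a] and [b] share less than two periods around [x]. *)
Definition corners a b x := forall m n,
  dist x (zpow a m * x)%g + dist x (zpow b n * x)%g
    - dist (zpow a m * x)%g (zpow b n * x)%g < 4 * trl a.

(* For [M = a ^ p * b ^ q] the broken path x, a ^ p x, M x, M a ^ p x, ... backtracks
   by less than [2 * trl a] at each turn, hence it follows the axis of [M] up to
   small neighbourhoods of the turns. *)
Lemma axis_power_product a b x p q : hyp a -> hyp b -> trl a = trl b -> axial a x ->
  corners a b x -> 9 <= p -> 4 <= q ->
  let M := (zpow a p * zpow b q)%g in
  [/\ hyp M,
      (p + q - 8) * trl a + axdist b x < trl M <= (p + q) * trl a + axdist b x &
      forall j, 2 <= j <= p - 2 -> axial M (zpow a j * x)%g /\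
        pos M (zpow a 2 * x)%g (zpow a j * x)%g ((j - 2) * trl a)].
Proof.
move=> aH bH lE ax C p_ge9 q_ge4 M; have l_gt0 := trl_gt0 a aH.
have D_ge0 := axdist_ge0 b x bH.
set l := trl a; set E := q * l + axdist b x.
have bq n : Z.abs n = q -> dist x (zpow b n * x)%g = E.
  by move=> nq; rewrite hyp_dist ?nq -?lE //; lia.
(* Twice the backtracks at the corners [a ^ p x] (for [e1]) and [M x] (for [e2]). *)
pose e1 j := (p - j) * l + E - dist (zpow a (j - p) * x)%g (zpow b q * x)%g.
pose e2 k := k * l + E - dist (zpow a k * x)%g (zpow b (- q) * x)%g.
have e1P j : j <= p -> 0 <= e1 j < 4 * l.
  move=> j_le; have := C (j - p) q; rewrite bq; last lia.
  have := dist_tri (zpow a (j - p) * x)%g x (zpow b q * x)%g.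
  rewrite (distC _ x) bq; last lia.
  by rewrite axial_dist_zpow // (_ : Z.abs (j - p) = p - j) -/l /e1; lia.
have e2P k : 0 <= k -> 0 <= e2 k < 4 * l.
  move=> k_ge; have := C k (- q); rewrite bq; last lia.
  have := dist_tri (zpow a k * x)%g x (zpow b (- q) * x)%g.
  rewrite (distC _ x) bq; last lia.
  by rewrite axial_dist_zpow // (_ : Z.abs k = k) -/l /e2; lia.
have aa i j : i <= j -> dist (zpow a i * x)%g (zpow a j * x)%g = (j - i) * l.
  by move=> ij; rewrite dist_zpow axial_dist_zpow // (_ : Z.abs (j - i) = j - i); lia.
have MM y z : dist (M * y)%g (M * z)%g = dist y z by rewrite distMl.
have jMx j : j <= p -> dist (zpow a j * x)%g (M * x)%g = (p - j) * l + E - e1 j.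
  by move=> jp; rewrite /M -mulA dist_zpowl /e1; lia.
have pMx : dist (zpow a p * x)%g (M * x)%g = E.
  by rewrite /M -mulA distMl bq; lia.
have pMk k : 0 <= k -> dist (zpow a p * x)%g (M * (zpow a k * x))%g = E + k * l - e2 k.
  move=> k_ge; rewrite /M -mulA distMl.
  have := dist_zpow b (- q) 0 x (zpow a k * x)%g.
  rewrite mul1g distC Z.sub_0_l Z.opp_involutive => <-; rewrite /e2; lia.
have xMk k : 0 <= k -> dist (M * x)%g (M * (zpow a k * x))%g = k * l.
  by move=> k_ge; rewrite MM axial_dist_zpow // (_ : Z.abs k = k); lia.
have jMk j k : j <= p -> 0 <= k ->
  dist (zpow a j * x)%g (M * (zpow a k * x))%g = (p - j) * l + E - e1 j + k * l - e2 k.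
  move=> jp k_ge; have := e1P j jp; have := e2P k k_ge => h1 h2.
  (* [4 <= q] enters here: the two corners of a [b]-segment together backtrack by less than its
     length. *)
  rewrite (dist_step _ (zpow a p * x)%g (M * x)%g _ (e1 j) (e2 k)).
  - by rewrite jMx // xMk.
  - by rewrite jMx // aa // pMx.
  - by rewrite pMk // pMx xMk //; lia.
  - by rewrite pMx /E; nia.
(* Backtracks are shorter than two periods, so the points with [2 <= j <= p - 2] stay on the axis of
   [M], and their displacement [T j] is its translation length. *)
pose T j := dist (zpow a j * x)%g (M * (zpow a j * x))%g.
have jMp j : 2 <= j <= p - 2 -> dist (zpow a j * x)%g (M * (zpow a p * x))%g = T j + (p - j) * l.
  move=> jP; have j_lep : j <= p by lia. have j_ge0 : 0 <= j by lia.
  have pl : dist x (zpow a p * x)%g = p * l.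
    by rewrite axial_dist_zpow // (_ : Z.abs p = p); lia.
  have jl : dist x (zpow a j * x)%g = j * l.
    by rewrite axial_dist_zpow // (_ : Z.abs j = j); lia.
  rewrite (dist_step _ (M * x)%g (M * (zpow a j * x))%g _ (e2 j) 0).
  - by rewrite MM aa // /T; lia.
  - by rewrite jMk // jMx // xMk //; lia.
  - by rewrite !MM aa // jl pl; lia.
  - by rewrite MM jl; have := e2P j j_ge0; nia.
have pT j : 2 <= j <= p - 2 -> dist (zpow a p * x)%g (M * (zpow a j * x))%g = E + j * l - e2 j.
  by move=> jP; rewrite pMk //; lia.
have TE j : 2 <= j <= p - 2 -> T j = (p - j) * l + E - e1 j + j * l - e2 j.
  by move=> jP; rewrite /T jMk; lia.
have jMMj j : 2 <= j <= p - 2 -> dist (zpow a j * x)%g (M * M * (zpow a j * x))%g = 2 * T j.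
  move=> jP; have h1 := e1P j ltac:(lia); have h2 := e2P j ltac:(lia).
  rewrite -mulA (dist_step _ (M * (zpow a j * x))%g (M * (zpow a p * x))%g _ 0 (e1 j)).
  - by rewrite jMp // MM pT // TE //; lia.
  - by rewrite jMp // MM aa /T; lia.
  - by rewrite !MM aa ?pT -/(T j) ?TE //; lia.
  - by rewrite MM aa; nia.
have T_gt j : 2 <= j <= p - 2 -> (p + q - 8) * l + axdist b x < T j <= (p + q) * l + axdist b x.
  by move=> jP; rewrite TE // /E; have := e1P j ltac:(lia); have := e2P j ltac:(lia); lia.
have M_neq1 : M <> 1%g.
  by move=> M1; have := T_gt 2 ltac:(lia); rewrite /T M1 mul1g distxx; nia.
have jax j : 2 <= j <= p - 2 -> axial M (zpow a j * x)%g by move=> jP; rewrite /axial jMMj.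
have MH : hyp M by split=> //; exists (zpow a 2 * x)%g; apply: jax; lia.
have TM j : 2 <= j <= p - 2 -> trl M = T j by move=> jP; rewrite (trl_axial M _ M_neq1 (jax j jP)).
have TM2 := TM 2 ltac:(lia); have T2 := T_gt 2 ltac:(lia).
split=> //; first by rewrite TM2.
have ax2 := jax 2 ltac:(lia).
have [k kP] := pos_ex M _ _ MH ax2 (jax (p - 2) ltac:(lia)).
(* The distance fixes [k] up to sign. A negative [k] would bring [M a ^ (p - 2) x] too close to
   [a ^ 2 x], because [p] is at least 9. *)
have kE : k = (p - 4) * l.
  have := pos_dist M _ _ _ 0 k MH ax2 (pos_self M _ MH ax2) kP; rewrite aa; last lia.
  have k1P := pos_zpow M _ _ _ 1 kP; rewrite zpow1 in k1P.
  have := pos_dist M _ _ _ 0 _ MH ax2 (pos_self M _ MH ax2) k1P.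
  have := e1P 2 ltac:(lia); have := e2P (p - 2) ltac:(lia).
  rewrite jMk; try lia.
  rewrite TM2 /E; clear -T2 l_gt0 D_ge0 p_ge9 q_ge4; rewrite -/l in l_gt0.
  by move: (T 2) T2 => t T2 *; nia.
move=> j jP; split; first exact: jax.
have [i iP] := pos_ex M _ _ MH ax2 (jax j jP).
have := pos_dist M _ _ _ 0 i MH ax2 (pos_self M _ MH ax2) iP; rewrite aa; last lia.
have := pos_dist M _ _ _ i k MH ax2 iP kP; rewrite aa; last lia.
rewrite kE -/l => h1 h2; suff <- : i = (j - 2) * l by [].
have := Z.mul_nonneg_nonneg (j - 2) l; have := Z.mul_nonneg_nonneg (p - 2 - j) l.
lia.
Qed.

(* The axes of [a] and of a [M]-conjugate of [a'] both follow the axis of [M] along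
   segments of length about [p * trl a] and [p * trl a']; as [p] dominates, these
   segments overlap so much that [a] and the conjugate agree at a point. *)
Lemma power_product_rigid a b q : hyp a -> hyp b -> trl a = trl b -> ~ commute a b ->
  4 <= q -> exists P0, forall p, P0 <= p -> let M := (zpow a p * zpow b q)%g in
  [/\ 9 <= p, hyp M, trl a < trl M & forall a' b', hyp a' -> hyp b' -> trl a' = trl b' ->
    (zpow a' p * zpow b' q)%g = M -> exists i, let c := zpow M i in
    [/\ commute a' (c * a * c^-1)%g, trl a' <= trl a
      & trl a' = trl a -> a' = (c * a * c^-1)%g]].
Proof.
move=> aH bH lE cab q_ge4; have l_gt0 := trl_gt0 a aH.
have b_a : b <> a by move=> E; apply: cab; rewrite E.
have b_aV : b <> a^-1%g by move=> E; apply: cab; rewrite E; apply/commuteV.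
have [x ax C] := corner_bound a b aH bH lE b_a b_aV.
have D_ge0 := axdist_ge0 b x bH.
(* A crude bound: [p] must exceed the part of a period of [M] that the [a]-segment misses, about
   [(q + 6) * trl a + axdist b x], with [trl a] steps to spare. *)
exists (5 * q * trl a + 30 * trl a + q + axdist b x + 30) => p p_big M.
have ql : q <= q * trl a by nia.
have p_ge9 : 9 <= p by lia.
have pl : 9 * trl a <= p * trl a by apply: Z.mul_le_mono_nonneg_r; lia.
have [MH Mtrl RP] := axis_power_product a b x p q aH bH lE ax C p_ge9 q_ge4.
rewrite -/M in MH Mtrl RP.
have ax2 : axial M (zpow a 2 * x)%g by apply: (proj1 (RP _ _)); lia.
split=> //; first by nia.
move=> a' b' aH' bH' lE' ME; have l'_gt0 := trl_gt0 a' aH'.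
have aR j : (a * (zpow a j * x) = zpow a (j + 1) * x)%g.
  by rewrite mulA -{1}[a]zpow1 -zpowD Z.add_comm.
(* In the first case there are no corners: [M] is a power of [a'], which thus translates the whole
   axis of [M]. On an [a]-segment [a'] and [a] commute, so [a] commutes with [M] and hence with [b],
   a contradiction. *)
case: (EM (b' = a' \/ b' = a'^-1%g)) => [b'_a'|nb'].
  have [s sE sP] : exists2 s, zpow a' s = M & p - q <= s.
    case: b'_a' => E; rewrite E in ME; [exists (p + q) | exists (p - q)]; try lia.
      by rewrite zpowD ME.
    by rewrite zpowD -ME -zpowN1 -zpowM; congr (_ * zpow _ _)%g; lia.
  have s_gt0 : 0 < s by lia.
  have [_ [trlM _]] := hyp_zpow a' s aH' ltac:(lia); rewrite sE in trlM.
  have l'l : trl a' <= 2 * trl a.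
    have [//|big] := Z_le_gt_dec (trl a') (2 * trl a); exfalso.
    have := Z.mul_le_mono_nonneg (p - q) s (2 * trl a + 1) (trl a') ltac:(lia) sP
      ltac:(lia) ltac:(lia).
    by rewrite trlM Z.abs_eq in Mtrl; lia.
  have ca'M : commute a' M by rewrite -sE; apply: commute_zpow.
  have [t tP] := commute_pos M _ a' MH ax2 ca'M.
  have a'2 : axial a' (zpow a 2 * x)%g by apply: (proj2 (commute_axial M _ a' MH ax2 ca'M aH'.1)).
  have tE : Z.abs t = trl a'.
    have R2P := pos_self M _ MH ax2.
    rewrite (trl_axial a' _ aH'.1 a'2) (pos_dist M _ _ _ _ _ MH ax2 R2P (tP _ _ R2P)); lia.
  have [_ R4P] := RP 4 ltac:(lia); have [_ R5P] := RP 5 ltac:(lia).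
  have [_ R3P] := RP 3 ltac:(lia); have [_ Rp3P] := RP (p - 3) ltac:(lia).
  have [_ Rp2P] := RP (p - 2) ltac:(lia); have [_ R2P] := RP 2 ltac:(lia).
  have caa' : commute a a'.
    apply: (mulIg (zpow a 4 * x)%g); rewrite -(mulA a a') -(mulA a' a) aR.
    have -> : 4 + 1 = 5 by lia.
    apply: (pos_inj M _ _ _ _ MH ax2 _ (tP _ _ R5P)).
    have -> : (5 - 2) * trl a + t = (4 - 2) * trl a + t + trl a by lia.
    apply: (pos_shift M _ a _ _ _ _ _ _ _ MH ax2 R2P Rp3P _ _ (tP _ _ R4P)); rewrite ?aR.
    - by have -> : (2 - 2) * trl a + trl a = (3 - 2) * trl a by lia.
    - have -> : p - 3 + 1 = p - 2 by lia.
      by have -> : (p - 3 - 2) * trl a + trl a = (p - 2 - 2) * trl a by lia.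
    - by lia.
  case: cab; apply: (commute_root b q) => //; first lia.
  have -> : zpow b q = ((zpow a p)^-1 * M)%g by rewrite /M mulA mulVg mul1g.
  apply: commuteM; first by apply/commuteV/commute_zpow.
  by rewrite -sE; apply: commute_zpow.
have [x' ax' C'] := corner_bound a' b' aH' bH' lE' (fun E => nb' (or_introl E))
  (fun E => nb' (or_intror E)).
have [_ Mtrl' RP'] := axis_power_product a' b' x' p q aH' bH' lE' ax' C' p_ge9 q_ge4.
rewrite ME in Mtrl' RP'.
have D'_ge0 := axdist_ge0 b' x' bH'.
have l'l : trl a' <= trl a.
  have [//|big] := Z_le_gt_dec (trl a') (trl a); exfalso.
  have := Z.mul_le_mono_nonneg_l (trl a + 1) (trl a') (p + q - 8) ltac:(lia) ltac:(lia).
  by lia.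
set T := trl M in Mtrl Mtrl'.
have T_gt0 : 0 < T by apply: trl_gt0.
have ax2' : axial M (zpow a' 2 * x')%g by apply: (proj1 (RP' _ _)); lia.
have [c' c'P] := pos_ex M _ _ MH ax2 ax2'.
have RP'' j : 2 <= j <= p - 2 ->
    pos M (zpow a 2 * x)%g (zpow a' j * x')%g (c' + (j - 2) * trl a').
  by move=> /RP'[_]; apply: pos_trans.
have aR' j : (a' * (zpow a' j * x') = zpow a' (j + 1) * x')%g.
  by rewrite mulA -{1}[a']zpow1 -zpowD Z.add_comm.
pose r := c' mod T; have rP := Z.mod_pos_bound c' T T_gt0.
have c'E := Z.div_mod c' T ltac:(lia); rewrite -/r in rP c'E.
(* A point of the [a']-segment inside a translate of the [a]-segment: either the start, at [r]
   modulo [T], is one, or steps of length [trl a'], at most [trl a], cross the gap without jumping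
   over the next translate. *)
have [i [k [k2 kp k_lo k_hi]]] : exists i k, [/\ 2 <= k, k <= p - 4 - trl a,
    i * T <= c' + (k - 2) * trl a'
    & c' + (k - 2) * trl a' <= i * T + (p - 6) * trl a].
  have [r_small|r_big] := Z_le_gt_dec r ((p - 6) * trl a).
    by exists (c' / T), 2; split; lia.
  pose m := (T - r) / trl a' + 1.
  have mE := Z.div_mod (T - r) (trl a') ltac:(lia).
  have mP := Z.mod_pos_bound (T - r) (trl a') l'_gt0.
  have m_le : m - 1 <= T - r.
    rewrite /m Z.add_simpl_r; apply: Z.div_le_upper_bound => //.
    by clear -rP l'_gt0; nia.
  have m_ge1 : 1 <= m by rewrite /m; have := Z.div_pos (T - r) (trl a') ltac:(lia) l'_gt0; lia.
  exists (c' / T + 1), (m + 2); split; [lia | | |].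
  - clear -m_le r_big Mtrl p_big ql q_ge4 l_gt0; nia.
  - clear -mE mP c'E l'_gt0; rewrite /m; nia.
  - clear -mE mP c'E l'l p_ge9 l_gt0 l'_gt0; rewrite /m; nia.
exists i => c; set ah := (c * a * c^-1)%g.
have ahR j : (ah * (c * (zpow a j * x)) = c * (zpow a (j + 1) * x))%g.
  by rewrite /ah -(aR j) -(mulA _ c^-1%g) mulKg -(mulA c a).
have cR j : 2 <= j <= p - 2 ->
    pos M (zpow a 2 * x)%g (c * (zpow a j * x))%g ((j - 2) * trl a + i * T).
  by move=> /RP[_]; apply: pos_zpow.
have shift w j : pos M (zpow a 2 * x)%g w j -> i * T <= j <= i * T + (p - 5) * trl a ->
    pos M (zpow a 2 * x)%g (ah * w)%g (j + trl a).
  move=> wP jP; have u0P := cR 2 ltac:(lia); have u1P := cR (p - 3) ltac:(lia).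
  apply: (pos_shift M _ ah _ _ _ _ _ _ _ MH ax2 u0P u1P _ _ wP); rewrite ?ahR; last by lia.
  - have -> : (2 - 2) * trl a + i * T + trl a = (2 + 1 - 2) * trl a + i * T by lia.
    by apply: cR; lia.
  - have -> : (p - 3 - 2) * trl a + i * T + trl a = (p - 3 + 1 - 2) * trl a + i * T by lia.
    by apply: cR; lia.
have xP := RP'' k ltac:(lia); have axP := RP'' (k + 1) ltac:(lia).
have ahxP := shift _ _ xP ltac:(lia).
have ahaxP := shift _ _ axP ltac:(lia).
have k_room : trl a <= (p - 3 - k) * trl a' by clear -kp l_gt0 l'_gt0; nia.
have k_pos : 0 <= (k - 2) * trl a' by apply: Z.mul_nonneg_nonneg; lia.
have aahxP : pos M (zpow a 2 * x)%g (a' * (ah * (zpow a' k * x')))%g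
    (c' + (k - 2) * trl a' + trl a + trl a').
  have u0P := RP'' 2 ltac:(lia); have u1P := RP'' (p - 3) ltac:(lia).
  apply: (pos_shift M _ a' _ _ _ _ _ _ _ MH ax2 u0P u1P _ _ ahxP); rewrite ?aR'; last by lia.
  - have -> : c' + (2 - 2) * trl a' + trl a' = c' + (2 + 1 - 2) * trl a' by lia.
    by apply: RP''; lia.
  - have -> : c' + (p - 3 - 2) * trl a' + trl a' = c' + (p - 3 + 1 - 2) * trl a' by lia.
    by apply: RP''; lia.
(* On the overlap [a'] and [ah] both act as translations, so they commute; with equal lengths they
   move the same point to the same place. *)
split=> // [|ll].
  apply: (mulIg (zpow a' k * x')%g); rewrite -(mulA a' ah) -(mulA ah a') aR'.
  apply: (pos_inj M _ _ _ _ MH ax2 aahxP).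
  have -> : c' + (k - 2) * trl a' + trl a + trl a' = c' + (k + 1 - 2) * trl a' + trl a by lia.
  exact: ahaxP.
apply: (mulIg (zpow a' k * x')%g); rewrite aR'.
apply: (pos_inj M _ _ _ _ MH ax2 axP).
have -> : c' + (k + 1 - 2) * trl a' = c' + (k - 2) * trl a' + trl a by lia.
exact: ahxP.
Qed.

Lemma conj_fixE (c x : G) : (c * x * c^-1)%g = x <-> commute c x.
Proof. by split=> /commuteJP. Qed.

(** Once [a'] is known, cancelling its power leaves the [q]-th power of [b'], and hyperbolic roots
    are unique. *)
Lemma power_product_rigid_pair a b q : hyp a -> hyp b -> trl a = trl b -> ~ commute a b ->
  4 <= q -> exists P0, forall p, P0 <= p -> let M := (zpow a p * zpow b q)%g in
  [/\ 9 <= p, hyp M, trl a < trl M & forall a' b', hyp a' -> hyp b' -> trl a' = trl b' ->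
    (zpow a' p * zpow b' q)%g = M -> exists i, let c := zpow M i in
    [/\ commute a' (c * a * c^-1)%g, trl a' <= trl a
      & trl a' = trl a -> a' = (c * a * c^-1)%g /\ b' = (c * b * c^-1)%g]].
Proof.
move=> aH bH lE cab q_ge4.
have [P0 P0P] := power_product_rigid a b q aH bH lE cab q_ge4.
exists P0 => p /P0P{P0P} [p_ge9 MH lM rig]; split=> // a' b' aH' bH' lE' ME.
have [i [com le eq]] := rig a' b' aH' bH' lE' ME; exists i; split=> // ll.
have a'E := eq ll; split=> //.
apply: (zpow_hyp_inj _ _ q bH' (hypJ _ b bH)); first lia.
apply: (mulgI (zpow a' p)); rewrite ME a'E !zpowJ; gsimp.
rewrite -(mulA (zpow (zpow a p * zpow b q) i) (zpow a p)).
by rewrite -(commute_zpow i (commute_refl (zpow a p * zpow b q)%g)) mulgK.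
Qed.

(** Conjugating both factors by [c] gives another factorization of [M]. By rigidity [c] acts on [a]
    and [b] like a power of [M], and only [1] centralizes both. *)
Lemma power_product_centralizer a b q : hyp a -> hyp b -> trl a = trl b -> ~ commute a b ->
  4 <= q -> exists P0, forall p, P0 <= p -> let M := (zpow a p * zpow b q)%g in
  forall c : G, commute c M -> exists i, c = zpow M i.
Proof.
move=> aH bH lE cab q_ge4.
have [P0 P0P] := power_product_rigid_pair a b q aH bH lE cab q_ge4.
exists P0 => p /P0P{P0P} [p_ge9 MH lM rig] M c cM.
have [||i [_ _ eq]] := rig _ _ (hypJ c a aH) (hypJ c b bH) _ _.
- by rewrite !trlJ.
- rewrite !zpowJ; gsimp; rewrite -(mulA c).
  exact/conj_fixE.
have [aE bE] := eq (trlJ c a aH); exists i.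
have E : (zpow M (- i) * c)%g = 1%g.
  apply: (centralizer_pair a b _ aH cab); apply/conj_fixE.
    rewrite zpowN; move: aE; rewrite -/M; set d := zpow M i => aE.
    rewrite invgM invgK; have -> : (d^-1 * c * a * (c^-1 * d) = d^-1 * (c * a * c^-1) * d)%g by gsimp.
    by rewrite aE; gsimp.
  rewrite zpowN; move: bE; rewrite -/M; set d := zpow M i => bE.
  rewrite invgM invgK; have -> : (d^-1 * c * b * (c^-1 * d) = d^-1 * (c * b * c^-1) * d)%g by gsimp.
  by rewrite bE; gsimp.
by apply: (mulgI (zpow M (- i))); rewrite E -zpowD Z.add_opp_diag_l.
Qed.

(** * Overlapping axes and independent powers *)

Lemma commute_overlap g h x K : hyp g -> hyp h -> axial g x ->
  (forall j, 0 <= j <= K -> axial h (zpow g j * x)%g) -> 2 + trl h <= K -> commute g h.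
Proof.
move=> gH hH gx hx Kbig; have lg := trl_gt0 g gH; have lh := trl_gt0 h hH.
have x0P : axial h x by rewrite -[x]mul1g; apply: (hx 0); lia.
have gg j : (g * (zpow g j * x) = zpow g (j + 1) * x)%g.
  by rewrite mulA -{1}[g]zpow1 -zpowD Z.add_comm.
have Kl : (K - 1) * trl g >= trl h by nia.
have [s [s1 sP]] : exists s, (s = 1 \/ s = - 1) /\ forall j, 0 <= j <= K ->
    pos h x (zpow g j * x)%g (s * (j * trl g)).
  have [k kP] := pos_ex h x _ hH x0P (hx K ltac:(lia)).
  have kd := pos_dist h x x _ 0 k hH x0P (pos_self h x hH x0P) kP.
  rewrite axial_dist_zpow // Z.abs_eq in kd; last lia.
  have [s [s1 sk]] : exists s, (s = 1 \/ s = - 1) /\ k = s * (K * trl g).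
    have [kE|kE] : k = K * trl g \/ k = - (K * trl g) by lia.
      by exists 1; lia.
    by exists (- 1); lia.
  exists s; split=> // j jP; have [i iP] := pos_ex h x _ hH x0P (hx j jP).
  suff <- : i = s * (j * trl g) by [].
  have := pos_dist h x x _ 0 i hH x0P (pos_self h x hH x0P) iP.
  have := pos_dist h x _ _ i k hH x0P iP kP.
  rewrite dist_zpow !axial_dist_zpow // (_ : Z.abs (K - j) = K - j); last lia.
  rewrite (_ : Z.abs j = j); last lia.
  have : 0 <= j * trl g by apply: Z.mul_nonneg_nonneg; lia.
  have : 0 <= (K - j) * trl g by apply: Z.mul_nonneg_nonneg; lia.
  by case: s1 sk => -> ->; lia.
have hP := pos_zpow h x x 0 s (pos_self h x hH x0P).
have P0 := sP 0 ltac:(lia); have P1 := sP 1 ltac:(lia).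
have PK1 := sP (K - 1) ltac:(lia); have PK := sP K ltac:(lia).
have hgx := pos_zpow h x _ _ s P1.
(* [s] is the direction in which [g] moves along the axis of [h]. The overlap has room for a step of
   each, so the two orders agree at [x]. *)
suff H : (g * zpow h s = zpow h s * g)%g.
  have cgh : commute g (zpow h s) by [].
  by apply: (commute_root h s) => //; lia.
apply: (mulIg x); rewrite -(mulA g) -(mulA _ g); rewrite zpow1 in hgx.
have K1 : K - 1 + 1 = K by lia.
apply: (pos_inj h x _ _ _ hH x0P _ hgx).
have -> : s * (1 * trl g) + s * trl h = 0 + s * trl h + s * trl g by lia.
case: s1 => sE; rewrite sE in hP P0 P1 PK1 PK hgx *.
  apply: (pos_shift h x g _ _ _ _ _ _ _ hH x0P P0 PK1 _ _ hP); rewrite ?gg ?K1; last lia.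
  - have -> : 1 * (0 * trl g) + 1 * trl g = 1 * (1 * trl g) by lia.
    by have -> : 0 + 1 = 1 by lia.
  - by have -> : 1 * ((K - 1) * trl g) + 1 * trl g = 1 * (K * trl g) by lia.
apply: (pos_shift h x g _ _ _ _ _ _ _ hH x0P PK1 P0 _ _ hP); rewrite ?gg ?K1; last lia.
- by have -> : -1 * ((K - 1) * trl g) + -1 * trl g = -1 * (K * trl g) by lia.
- have -> : -1 * (0 * trl g) + -1 * trl g = -1 * (1 * trl g) by lia.
  by have -> : 0 + 1 = 1 by lia.
Qed.

(** Both ends are equally far from the axis of [u]; all but [axdist u x] steps at either end of the
    run lie on that axis, and they suffice for [commute_overlap]. *)
Lemma commute_run g u x y L : hyp g -> hyp u -> axial g x -> axdist u y = axdist u x ->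
  (forall j, 0 <= j <= L -> dist x (zpow g j * x)%g + dist (zpow g j * x)%g y = dist x y) ->
  2 * axdist u x + trl u + 2 <= L -> commute g u.
Proof.
move=> gH uH gx yD btw Lbig; have lg := trl_gt0 g gH; have D_ge0 := axdist_ge0 u x uH.
apply: (commute_overlap g u (zpow g (axdist u x) * x)%g (L - 2 * axdist u x)) => //.
- exact: axial_zpow.
- move=> j jP; apply/axialP => //; rewrite mulA -zpowD.
  set i := j + axdist u x; have iP : axdist u x <= i <= L - axdist u x by rewrite /i; lia.
  have [] := axdist_btw u x y (zpow g i * x)%g uH (btw i ltac:(lia)); first by [].
  have := axdist_ge0 u (zpow g i * x)%g uH; have := btw i ltac:(lia).
  have := btw L ltac:(lia); have := len_ge0 ((zpow g L * x)^-1 * y)%g.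
  rewrite !axial_dist_zpow // yD (_ : Z.abs i = i) 1?(_ : Z.abs L = L); try lia.
  have : axdist u x <= i * trl g by nia.
  have : axdist u x <= (L - i) * trl g by nia.
  lia.
- lia.
Qed.

Lemma zpowSl (g : G) n : zpow g (Z.succ n) = (g * zpow g n)%g.
Proof. by rewrite -Z.add_1_l zpowD zpow1. Qed.

Lemma zpowMC (g h : G) n : (g * zpow (h * g) n = zpow (g * h) n * g)%g.
Proof.
have -> : (h * g = g^-1 * (g * h) * g^-1^-1)%g by gsimp.
by rewrite zpowJ; gsimp.
Qed.

(* Twice the length of the common part of the paths from [x] to [y] and from [x] to [z]. *)
Definition turn x y z := dist x y + dist x z - dist y z.

(** A ping-pong step: [w * x] and [A^-1 * x] part early, so the path to [A * w * x] begins like the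
    one to [A * x]. A separate [V] allows the inverse to be given as a power with negated
    exponent. *)
Lemma turn_step (A V B w : G) x K : V = A^-1%g -> turn x (V * x)%g (w * x)%g < K ->
  turn x (A * x)%g (B * x)%g < K -> K <= dist x (A * x)%g ->
  turn x (B * x)%g (A * w * x)%g < K.
Proof.
rewrite /turn => VE tw tAB Kle.
have AV y : (A * (V * y) = y)%g by rewrite VE mulVKg.
have uv : dist (A * x)%g x = dist x (V * x)%g by rewrite -(distMl A x) AV.
have ou : dist (A * w * x)%g (A * x)%g = dist x (w * x)%g by rewrite -mulA distMl distC.
have ov : dist (A * w * x)%g x = dist (V * x)%g (w * x)%g.
  by rewrite -(distMl A (V * x)%g) AV mulA distC.
have xA : dist x (A * x)%g = dist x (V * x)%g by rewrite distC uv.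
have := dist_step (A * w * x)%g (A * x)%g x (B * x)%g
  (turn x (V * x)%g (w * x)%g) (turn x (A * x)%g (B * x)%g).
rewrite (distC (B * x)%g) (distC x (A * w * x)%g).
move: Kle tAB tw; rewrite /turn uv ou ov xA => Kle tAB tw H.
by have := H ltac:(lia) ltac:(lia) ltac:(lia); lia.
Qed.

Lemma power_dist_ge g x n : hyp g -> 4 <= Z.abs n -> 4 * trl g <= dist x (zpow g n * x)%g.
Proof.
move=> gH n4; rewrite hyp_dist //; last lia.
have := axdist_ge0 g x gH; have := trl_gt0 g gH; nia.
Qed.

Lemma corners_turns a b x p q w (k : nat) : hyp a -> hyp b -> trl a = trl b ->
  corners a b x -> 4 <= p -> 4 <= q ->
  turn x (zpow a (- p) * x)%g (w * x)%g < 4 * trl a ->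
  turn x (zpow a (- p) * x)%g (zpow (zpow b q * zpow a p) (Z.of_nat k) * w * x)%g < 4 * trl a.
Proof.
move=> aH bH lE C p4 q4 tw; elim: k => [|k IHk]; first by rewrite mul1g.
rewrite Nat2Z.inj_succ zpowSl; move: (zpow _ (Z.of_nat k)) IHk => W IHk.
have -> : (zpow b q * zpow a p * W * w = zpow b q * (zpow a p * (W * w)))%g by rewrite !mulA.
have ab := C p (- q); have ba := C (- p) q.
apply: (turn_step _ (zpow b (- q))); first exact: zpowN.
- apply: (turn_step _ (zpow a (- p))) => //; first exact: zpowN.
  by apply: power_dist_ge => //; lia.
- by rewrite /turn (distC (zpow b q * x)%g); lia.
- by rewrite lE; apply: power_dist_ge => //; lia.
Qed.

(** The path from [x] to its image under the product starts with at least [p - 2] steps on the axis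
    of [a]. Its ends are equally far from the axis of [u] when the product commutes with [u], so
    [commute_run] applies. *)
Lemma commute_power_product a b x u p q w (k : nat) : hyp a -> hyp b -> trl a = trl b ->
  axial a x -> corners a b x -> 4 <= p -> 4 <= q ->
  turn x (zpow a (- p) * x)%g (w * x)%g < 4 * trl a ->
  hyp u -> 2 * axdist u x + trl u + 4 <= p ->
  commute (zpow a p * zpow (zpow b q * zpow a p) (Z.of_nat k) * w)%g u -> commute a u.
Proof.
move=> aH bH lE ax C p4 q4 tw uH p_big; have l_gt0 := trl_gt0 a aH.
have := corners_turns a b x p q w k aH bH lE C p4 q4 tw.
rewrite -(mulA (zpow a p)); move: (zpow _ _ * w)%g => {tw}w tw com.
set y := (zpow a p * w * x)%g.
have px : dist x (zpow a p * x)%g = p * trl a.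
  by rewrite axial_dist_zpow // (_ : Z.abs p = p) //; lia.
have pNx : dist x (zpow a (- p) * x)%g = p * trl a.
  by rewrite axial_dist_zpow // (_ : Z.abs (- p) = p) //; lia.
have py : dist (zpow a p * x)%g y = dist x (w * x)%g by rewrite /y -mulA distMl.
have xy : dist x y = dist (zpow a (- p) * x)%g (w * x)%g.
  rewrite -(distMl (zpow a (- p)) x y); congr (dist _ _).
  by rewrite /y !mulA -zpowD Z.add_opp_diag_l mul1g.
apply: (commute_run a u x y (p - 2)) => //; last lia.
  rewrite /axdist; have -> : (u * y = zpow a p * w * (u * x))%g.
    by rewrite /y mulA -com -mulA.
  by rewrite distMl.
move=> j jP; have jx : dist x (zpow a j * x)%g = j * trl a.
  by rewrite axial_dist_zpow // (_ : Z.abs j = j) //; lia.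
have jp : dist (zpow a j * x)%g (zpow a p * x)%g = (p - j) * trl a.
  by rewrite dist_zpow axial_dist_zpow // (_ : Z.abs (p - j) = p - j) //; lia.
have := len_four_point (zpow a j * x)%g y x (zpow a p * x)%g.
have := dist_tri x (zpow a j * x)%g y.
rewrite (distC (zpow a j * x)%g x) (distC y (zpow a p * x)%g) (distC y x) jp jx px py.
move: tw; rewrite /turn pNx -xy.
have : 2 * trl a <= (p - j) * trl a by apply: Z.mul_le_mono_nonneg_r; lia.
by lia.
Qed.

Lemma corners_inv a b x : hyp a -> trl a^-1%g = trl a ->
  corners a b x -> corners (a^-1)%g (b^-1)%g x.
Proof.
move=> aH lE C m n; have := C (- m) (- n).
by rewrite lE !zpowVg.
Qed.

Lemma hyp_inv a : hyp a -> hyp a^-1%g /\ trl a^-1%g = trl a.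
Proof.
move=> aH; have [H [E _]] := hyp_zpow a (- 1) aH ltac:(lia).
by rewrite -zpowN1 E; split=> //; lia.
Qed.

(* A nonzero power of [M = a ^ p * b ^ q] translates along long parts of axes of
   conjugates of [a] or [b], which the centralizer of [u] cannot do; the last factor
   [a ^ n] is absorbed at one end of the path when [m > 0], at the other when [m < 0]. *)
Lemma power_product_independent a b u : hyp a -> hyp b -> trl a = trl b -> ~ commute a b ->
  hyp u -> ~ commute a u -> ~ commute b u -> exists Q0, forall p q, Q0 <= q -> Q0 <= p ->
  forall m n, commute (zpow (zpow a p * zpow b q) m * zpow a n)%g u -> m = 0.
Proof.
move=> aH bH lE cab uH cau cbu.
have b_a : b <> a by move=> E; apply: cab; rewrite E.
have b_aV : b <> a^-1%g by move=> E; apply: cab; rewrite E; apply/commuteV.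
have [x ax C] := corner_bound a b aH bH lE b_a b_aV.
(* For negative [m] the product begins with a power of [b^-1], which calls for a base point on the
   axis of [b]. *)
have [y ay C'] : exists2 y, axial b y & corners b a y.
  apply: corner_bound => // E; [exact: b_a | by apply: b_aV; rewrite E invgK].
have Dx := axdist_ge0 u x uH; have Dy := axdist_ge0 u y uH; have lu := trl_gt0 u uH.
exists (2 * axdist u x + 2 * axdist u y + trl u + 4) => p q q_big p_big m n com.
have [[k mE]|[//|[k mE]]] : (exists k : nat, m = Z.succ (Z.of_nat k)) \/ m = 0 \/
    exists k : nat, m = - Z.succ (Z.of_nat k).
- have [mE|[mE|mE]] : 0 < m \/ m = 0 \/ m < 0 by lia.
  + by left; exists (Z.to_nat (m - 1)); lia.
  + by right; left.
  + by right; right; exists (Z.to_nat (- m - 1)); lia.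
- case: cau; apply: (commute_power_product a b x u p q (zpow b q * zpow a n) k) => //; try lia.
    apply: (turn_step _ (zpow b (- q))); first exact: zpowN.
    + by have := C n (- q); rewrite /turn (distC (zpow a n * x)%g); lia.
    + by have := C (- p) q; rewrite /turn (distC (zpow a (- p) * x)%g) ; lia.
    + by rewrite lE; apply: power_dist_ge => //; lia.
  by rewrite mE zpowS in com; rewrite zpowMC; gsimp; move: com; gsimp.
have [aVH aVl] := hyp_inv a aH; have [bVH bVl] := hyp_inv b bH.
case: cbu; suff : commute b^-1%g u by move=> /commute_sym/commuteV; rewrite invgK => /commute_sym.
apply: (commute_power_product b^-1%g a^-1%g y u q p (zpow a (n - p)) k) => //; try lia.
- apply/(axialP _ _ bVH); rewrite -zpowN1 (hyp_zpow b (- 1) bH ltac:(lia)).2.2.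
  exact/axialP.
- exact: corners_inv.
- rewrite bVl zpowVg Z.opp_involutive; have := C' q (n - p); rewrite /turn; lia.
suff <- : (zpow (zpow a p * zpow b q) m * zpow a n =
    zpow b^-1 q * zpow (zpow a^-1 p * zpow b^-1 q) (Z.of_nat k) * zpow a (n - p))%g by [].
have -> : n - p = - p + n by lia.
rewrite !zpowVg zpowMC zpowD mE -zpowVg zpowS invgM -!zpowN.
by rewrite !mulA.
Qed.

(** * Roots of perturbed powers *)

Lemma turn_btw x y z w : dist x z + dist z y = dist x y -> 2 * dist x z <= turn x y w ->
  dist x z + dist z w = dist x w.
Proof.
rewrite /turn => btw le; have := len_four_point z w x y; have := dist_tri x z w.
rewrite (distC z x) (distC w y) (distC w x); lia.
Qed.

Lemma turn_bounded a f x : hyp a -> hyp f -> axial a x -> ~ commute a f ->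
  exists2 B, 0 <= B & forall m k, turn x (zpow a m * x)%g (zpow f k * x)%g <= B.
Proof.
move=> aH fH ax caf; have l_gt0 := trl_gt0 a aH; have D_ge0 := axdist_ge0 f x fH.
pose L := 2 * axdist f x + trl f + 2; have lf := trl_gt0 f fH.
exists (2 * L * trl a) => [|m k]; first by rewrite /L; nia.
have [//|big] := Z_le_gt_dec (turn x (zpow a m * x)%g (zpow f k * x)%g) (2 * L * trl a).
exfalso; apply: caf.
have am := axial_dist_zpow a x m aH ax.
have m_big : L <= Z.abs m.
  have := dist_tri x (zpow a m * x)%g (zpow f k * x)%g.
  by move: big; rewrite /turn am; nia.
pose e := Z.sgn m; have e_neq0 : e <> 0 by rewrite /e; lia.
suff : commute f (zpow a e) by move=> /(commute_root a e f aH e_neq0)/commute_sym.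
have [gH [gl gD]] := hyp_zpow a e aH e_neq0; apply: commute_sym.
apply: (commute_run (zpow a e) f x (zpow f k * x)%g L) => //; last lia.
- by apply/(axialP _ _ gH); rewrite gD; apply/axialP.
- exact: axdist_zpow.
move=> j jP; rewrite -zpowM; have ej : dist x (zpow a (e * j) * x)%g = j * trl a.
  by rewrite axial_dist_zpow //; congr (_ * _); rewrite /e; lia.
apply: (turn_btw _ (zpow a m * x)%g).
  rewrite ej dist_zpow am axial_dist_zpow // -Z.mul_add_distr_r; congr (_ * _); rewrite /e.
  by have [E|E] : Z.sgn m = 1 \/ Z.sgn m = - 1; rewrite ?E; lia.
rewrite ej; suff : j * trl a <= L * trl a by lia.
by apply: Z.mul_le_mono_nonneg_r; lia.
Qed.

(** Since [trl b = trl a], the factor [f ^ k] moves [x] only a bounded distance. The axis of [b]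
    then meets that of [a] in a full step, where [b] acts as [a] or its inverse; the inverse would
    make a power of [f] commute with [a]. *)
Lemma perturbed_power_root a f : hyp a -> hyp f -> ~ commute a f ->
  exists2 N0, 1 <= N0 & forall N, N0 <= N -> forall b k, hyp b -> trl b = trl a ->
  zpow b N = (zpow a N * zpow f k)%g -> b = a.
Proof.
move=> aH fH caf; have l_gt0 := trl_gt0 a aH; have [_ [x ax]] := aH.
have [B B_ge0 BP] := turn_bounded a f x aH fH ax caf.
exists (4 * B + 4) => [|N N_big b k bH lE E]; first by lia.
set F := dist x (zpow f k * x)%g.
have F_ge0 : 0 <= F by apply: len_ge0.
set Pr := zpow b N in E.
have [PrH [Prl PrD]] := hyp_zpow b N bH ltac:(lia); rewrite -/Pr in PrH Prl PrD.
have Nl : N <= N * trl a by nia.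
have {}Prl : trl Pr = N * trl a by rewrite Prl lE Z.abs_eq; lia.
have aN : dist x (zpow a N * x)%g = N * trl a by rewrite axial_dist_zpow // Z.abs_eq; lia.
have aNx : dist (zpow a N * x)%g (Pr * x)%g = F by rewrite E -mulA distMl.
have xP : dist x (Pr * x)%g = N * trl a + axdist b x.
  by rewrite -PrD /axdist Prl; lia.
have F_le : F <= 2 * B.
  have [F_le|F_gt] := Z_le_gt_dec F B; first by lia.
  (* The path [x], [a ^ N x], [Pr x], [Pr a ^ N x], [Pr Pr x] yields the translation length
     [N * trl a + F - c1 - c2]; as it equals [N * trl a], [F] is [c1 + c2]. *)
  pose c1 := turn x (zpow a (- N) * x)%g (zpow f k * x)%g.
  pose c2 := turn x (zpow a N * x)%g (zpow f (- k) * x)%g.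
  have c1B : c1 <= B := BP _ _; have c2B : c2 <= B := BP _ _.
  have xNx : dist x (zpow a (- N) * x)%g = N * trl a.
    by rewrite axial_dist_zpow // (_ : Z.abs (- N) = N); lia.
  have xkx : dist x (zpow f (- k) * x)%g = F.
    rewrite distC; have := dist_zpow f (- k) 0 x x; rewrite mul1g => ->.
    by congr (dist _ (zpow _ _ * _)%g); lia.
  have xPc : dist x (Pr * x)%g = N * trl a + F - c1.
    rewrite /c1 /turn xNx -/F E -mulA.
    have := dist_zpow a (- N) 0 x (zpow a N * (zpow f k * x))%g.
    have -> : dist x (zpow a N * (zpow f k * x))%g
      = dist (zpow a (- N) * x)%g (zpow f k * x)%g.
      rewrite -(distMl (zpow a (- N)) x); congr (dist _ _).
      by rewrite mulA -zpowD Z.add_opp_diag_l mul1g.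
    by lia.
  have NPN : dist (zpow a N * x)%g (Pr * (zpow a N * x))%g = F + N * trl a - c2.
    rewrite /c2 /turn xkx aN E -mulA distMl.
    have -> : dist x (zpow f k * (zpow a N * x))%g
      = dist (zpow f (- k) * x)%g (zpow a N * x)%g.
      rewrite -(distMl (zpow f (- k)) x); congr (dist _ _).
      by rewrite (mulA (zpow f (- k))) -zpowD Z.add_opp_diag_l mul1g.
    by rewrite distC; lia.
  have PPN : dist (Pr * x)%g (Pr * (zpow a N * x))%g = N * trl a by rewrite distMl.
  have xPN : dist x (Pr * (zpow a N * x))%g = dist x (Pr * x)%g + N * trl a - c2.
    rewrite -PPN; apply: (dist_step x (zpow a N * x)%g (Pr * x)%g _ c1); lia.
  have PNPP : dist (Pr * (zpow a N * x))%g (Pr * (Pr * x))%g = F by rewrite distMl.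
  have PPP : dist (Pr * x)%g (Pr * (Pr * x))%g = dist x (Pr * x)%g by rewrite distMl.
  have := dist_step x (Pr * x)%g (Pr * (zpow a N * x))%g (Pr * (Pr * x))%g c2 c1.
  rewrite PPN PNPP PPP => /(_ ltac:(lia) ltac:(lia) ltac:(lia)).
  have := hyp_dist Pr x 2 PrH ltac:(lia); rewrite (zpowD Pr 1 1) zpow1 -mulA.
  have := hyp_dist Pr x 1 PrH ltac:(lia); rewrite zpow1.
  by lia.
have bx_ge0 := axdist_ge0 b x bH.
have D_le : axdist b x <= 2 * B.
  have := dist_tri x (zpow a N * x)%g (Pr * x)%g; lia.
have onb j : B <= j <= B + 1 -> axial b (zpow a j * x)%g.
  move=> jP; have jx : dist x (zpow a j * x)%g = j * trl a.
    by rewrite axial_dist_zpow // Z.abs_eq; lia.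
  have jN : dist (zpow a j * x)%g (zpow a N * x)%g = (N - j) * trl a.
    by rewrite dist_zpow axial_dist_zpow // Z.abs_eq; lia.
  have h1 : B <= j * trl a by nia.
  have h2 : B <= (N - j) * trl a by nia.
  have btw : dist x (zpow a j * x)%g + dist (zpow a j * x)%g (Pr * x)%g = dist x (Pr * x)%g.
    apply: (turn_btw _ (zpow a N * x)%g); rewrite ?jx ?jN ?aN; first by lia.
    by rewrite /turn aN xP aNx; lia.
  apply/axialP => //; have := axdist_btw b x (Pr * x)%g _ bH btw.
  have := axdist_ge0 b (zpow a j * x)%g bH.
  by rewrite axdist_zpow; move: btw; rewrite jx xP; lia.
have w0 := onb B ltac:(lia); have w1 := onb (B + 1) ltac:(lia).
have w1E : (zpow a (B + 1) * x = a * (zpow a B * x))%g.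
  by rewrite Z.add_comm zpowD zpow1 -mulA.
have [i iP] := pos_ex b _ _ bH w0 w1.
have w0P := pos_self b _ bH w0.
have i_l : Z.abs i = trl b.
  have := pos_dist b _ _ _ 0 i bH w0 w0P iP.
  by rewrite dist_zpow axial_dist_zpow // (_ : Z.abs (B + 1 - B) = 1) ?lE; lia.
have [iE|iE] : i = 0 + 1 * trl b \/ i = 0 + - 1 * trl b by lia.
  apply: (mulIg (zpow a B * x)%g); rewrite -w1E; apply/esym.
  rewrite iE in iP; exact: (pos_inj b _ _ _ _ bH w0 iP (pos_zpow b _ _ 0 1 w0P)).
have {iE} aE : (a = b^-1)%g.
  apply: (mulIg (zpow a B * x)%g); rewrite -w1E.
  rewrite iE in iP; exact: (pos_inj b _ _ _ _ bH w0 iP (pos_zpow b _ _ 0 (- 1) w0P)).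
case: caf; have bE : b = a^-1%g by rewrite aE invgK.
have k_neq0 : k <> 0.
  move=> k0; have [[]] := hyp_zpow a (2 * N) aH ltac:(lia); case.
  have -> : 2 * N = N + N by lia.
  move: E; rewrite /Pr bE zpowVg k0 /= mulg1 zpowD => E.
  by rewrite -{2}E -zpowD Z.add_opp_diag_r.
apply: (commute_root f k) => //.
have -> : zpow f k = (zpow a (- N) * zpow a (- N))%g.
  by rewrite -{2}zpowVg -bE -/Pr E mulA -zpowD Z.add_opp_diag_l mul1g.
by apply: commuteM; apply: commute_zpow.
Qed.

(** * Self-centralizing elements and twisted products *)

Definition self_centralizing g := forall c : G, commute c g -> exists i, c = zpow g i.

Lemma short_noncommute g u (t : G) : hyp g -> self_centralizing g -> hyp u ->
  trl u < trl g -> ~ commute u (t * g * t^-1)%g.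
Proof.
move=> gH gC uH lt com; have uJ : commute (t^-1 * u * t)%g g.
  by apply: (@commuteJ_inv _ t); move: com; gsimp.
have [i E] := gC _ uJ; have uE : u = zpow (t * g * t^-1)%g i.
  by rewrite zpowJ -E; gsimp.
have i_neq0 : i <> 0 by move=> i0; apply: uH.1; rewrite uE i0.
have tgH := hypJ t g gH; have [_ [ulE _]] := hyp_zpow _ i tgH i_neq0.
by move: lt; rewrite uE ulE trlJ //; have := trl_gt0 g gH; nia.
Qed.

Lemma short_noncommute1 g u : hyp g -> self_centralizing g -> hyp u ->
  trl u < trl g -> ~ commute u g.
Proof. by move=> gH gC uH lt; have := short_noncommute g u 1%g gH gC uH lt; gsimp. Qed.

Variable F : G -> Prop.
Hypothesis F_mul : forall x y, F x -> F y -> F (x * y)%g.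
Hypothesis F_inv : forall x, F x -> F (x^-1)%g.
Hypothesis F_conj : forall x (t : G), F x -> F (t * x * t^-1)%g.
Hypothesis F_hyp : forall x, F x -> x <> 1%g -> hyp x.

Lemma F_zpow x n : F x -> F (zpow x n).
Proof.
move=> Fx; have F1 : F 1%g by rewrite -(mulVg x); apply: F_mul => //; apply: F_inv.
elim/Z.peano_ind: n => [//|n IHn|n IHn]; first by rewrite zpowS; apply: F_mul.
have -> : zpow x (Z.pred n) = (zpow x n * x^-1)%g.
  by apply: (mulIg x); rewrite -zpowS Z.succ_pred mulgVK.
by apply: F_mul => //; apply: F_inv.
Qed.

Lemma twist_centralizer a (t : G) : hyp a -> ~ commute a (t * a * t^-1)%g ->
  exists p q, let M := (zpow a p * (t * zpow a q * t^-1))%g in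
  [/\ hyp M, p <> 0, q <> 0 & self_centralizing M].
Proof.
move=> aH nc; have bH := hypJ t a aH; have lE := esym (trlJ t a aH).
have [P0 P0P] := power_product_rigid_pair a _ 4 aH bH lE nc ltac:(lia).
have [P1 P1P] := power_product_centralizer a _ 4 aH bH lE nc ltac:(lia).
have [p [pP0 pP1]] : exists p, P0 <= p /\ P1 <= p by exists (Z.max P0 P1); lia.
have [p9 MH _ _] := P0P p ltac:(lia).
have MC := P1P p ltac:(lia); exists p, 4; rewrite -zpowJ; split=> //; lia.
Qed.

(** Rigidity makes [a'] commute with a conjugate of [a], of which it is then a power because [a] is
    self-centralizing; being no longer than [a], it has the same translation length, as the full
    conclusion of rigidity requires. *)
Lemma twist_rigid a (t : G) u : hyp a -> self_centralizing a ->
  ~ commute a (t * a * t^-1)%g -> hyp u -> trl u <= trl a ->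
  exists p q, let M := (zpow a p * (t * zpow a q * t^-1))%g in
  [/\ hyp M, trl a < trl M, self_centralizing M,
    forall a' (t' : G), F a' -> (zpow a' p * (t' * zpow a' q * t'^-1))%g = M ->
      exists i, let c := zpow M i in
      a' = (c * a * c^-1)%g /\
      (t' * a' * t'^-1)%g = (c * (t * a * t^-1) * c^-1)%g
    & trl u < trl a -> forall m n, commute (zpow M m * zpow a n)%g u -> m = 0].
Proof.
move=> aH aC nc uH _; have bH := hypJ t a aH; have lE := esym (trlJ t a aH).
have [Q0 Q0P] : exists Q0, trl u < trl a -> forall p q, Q0 <= q -> Q0 <= p -> forall m n,
    commute (zpow (zpow a p * zpow (t * a * t^-1) q) m * zpow a n)%g u -> m = 0.
  have [lt|ge] := Z_lt_ge_dec (trl u) (trl a); last by exists 0; lia.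
  have [Q0 Q0P] := power_product_independent a _ u aH bH lE nc uH
    (fun E => short_noncommute1 a u aH aC uH lt (commute_sym E))
    (fun E => short_noncommute a u t aH aC uH lt (commute_sym E)).
  by exists Q0 => _; apply: Q0P.
have [q [q4 qQ0]] : exists q, 4 <= q /\ Q0 <= q by exists (Z.max 4 Q0); lia.
have [P0 P0P] := power_product_rigid_pair a _ q aH bH lE nc ltac:(lia).
have [P1 P1P] := power_product_centralizer a _ q aH bH lE nc ltac:(lia).
have [p [pP0 [pP1 pQ0]]] : exists p, P0 <= p /\ P1 <= p /\ Q0 <= p.
  by exists (Z.max (Z.max P0 P1) Q0); lia.
have [p9 MH lM rig] := P0P p ltac:(lia).
have MC := P1P p ltac:(lia); exists p, q; rewrite -zpowJ; split=> //; last first.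
  by move=> lt; apply: Q0P => //; lia.
move=> a' t' Fa' E; rewrite -zpowJ in E.
have a'_neq1 : a' <> 1%g.
  by move=> a1; apply: MH.1; rewrite -E a1; gsimp; rewrite !zpow1g; gsimp.
have aH' := F_hyp _ Fa' a'_neq1.
have [i [com le eq]] := rig a' _ aH' (hypJ t' a' aH') (esym (trlJ t' a' aH')) E.
exists i; apply: eq; set c := zpow _ i in com.
have [j E'] : exists j, (c^-1 * a' * c)%g = zpow a j.
  by apply: aC; apply: (@commuteJ_inv _ c); move: com; gsimp.
have a'E : a' = zpow (c * a * c^-1)%g j by rewrite zpowJ -E'; gsimp.
have j_neq0 : j <> 0 by move=> j0; apply: a'_neq1; rewrite a'E j0.
have [_ [a'l _]] := hyp_zpow _ j (hypJ c a aH) j_neq0.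
by move: le; rewrite {1 2}a'E a'l trlJ //; have := trl_gt0 a aH; nia.
Qed.

(** * Test words *)

Section TestWords.
Variables (W : groupType) (e : W -> G).
Hypothesis eM : {morph e : x y / (x * y)%g}.
Implicit Types (v s r : W) (f : W -> G).

Definition hom f := {morph f : x y / (x * y)%g}.

Lemma homV f v : hom f -> f v^-1%g = (f v)^-1%g.
Proof.
move=> fM; have f1 : f 1%g = 1%g.
  by apply: (mulgI (f 1%g)); rewrite -fM !mulg1.
by apply: (mulgI (f v)); rewrite -fM !mulgV.
Qed.

Lemma hom_zpow f v n : hom f -> f (zpow v n) = zpow (f v) n.
Proof.
move=> fM; have f1 : f 1%g = 1%g.
  by apply: (mulgI (f 1%g)); rewrite -fM !mulg1.
elim/Z.peano_ind: n => [//|n IHn|n IHn]; first by rewrite !zpowS fM IHn.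
apply: (mulIg (f v)); rewrite -zpowS Z.succ_pred -IHn -fM -zpowS Z.succ_pred //.
Qed.

Lemma homJ f (c : G) : hom f -> hom (fun v => c * f v * c^-1)%g.
Proof. by move=> fM v s; rewrite fM; gsimp. Qed.

Definition F_valued v := forall f, hom f -> F (f v).

(* [v] determines the elements of [S] up to a common conjugation. *)
Definition rigid v (S : W -> Prop) := forall f, hom f -> f v = e v ->
  exists k, let c := zpow (e v) k in forall s, S s -> f s = (c * e s * c^-1)%g.

Definition test_word u v S := [/\ F_valued v, hyp (e v), self_centralizing (e v),
  trl (e u) < trl (e v) & rigid v S].

Definition twist v s p q := (zpow v p * (s * zpow v q * s^-1))%g.

Lemma F_valued_twist v s p q : F_valued v -> F_valued (twist v s p q).
Proof.
move=> Fv f fM; rewrite /twist !fM homV // !hom_zpow //.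
by apply: F_mul; [|apply: F_conj]; apply: F_zpow; apply: Fv.
Qed.

Lemma hom_twist f v s p q : hom f ->
  f (twist v s p q) = (zpow (f v) p * (f s * zpow (f v) q * (f s)^-1))%g.
Proof. by move=> fM; rewrite /twist !fM homV // !hom_zpow. Qed.

Lemma conj_inj (c x y : G) : (c * x * c^-1 = c * y * c^-1)%g -> x = y.
Proof. by move=> /mulIg/mulgI. Qed.

Lemma cosetP (c d a : G) : (c * a * c^-1 = d * a * d^-1)%g -> commute (d^-1 * c)%g a.
Proof.
move=> E; apply/commuteJP; rewrite invgM invgK; move: E; gsimp.
by move/(canRL (mulgK _)) => E; rewrite -!(mulA d^-1%g) E; gsimp.
Qed.

(** Two twists are needed. The first, by [w ^ N0], ties [w] to [v], leaving a conjugation by a power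
    [d] of [e y] and an error in the centralizer of [e v]; as [w] is conjugate to [u], its length is
    known and the root is unique. The second, by [u ^ N1], fixes [u] itself, which kills both [d]
    and the conjugation [a] left by the rigidity of [v]. *)
Lemma test_word_extend u v (S : W -> Prop) r : F_valued u -> hyp (e u) -> S u ->
  test_word u v S -> exists v', test_word u v' (fun s => S s \/ s = (r * u * r^-1)%g).
Proof.
move=> Fu uH Su [Fv vH vC luv vR]; set w := (r * u * r^-1)%g.
have eC : e w = (e r * e u * (e r)^-1)%g by rewrite /w !eM homV.
have wH : hyp (e w) by rewrite eC; apply: hypJ.
have lw : trl (e w) = trl (e u) by rewrite eC trlJ.
have nwv : ~ commute (e w) (e v) by apply: short_noncommute1 => //; rewrite lw.
have [N0 N0_ge1 root] := perturbed_power_root _ _ wH vH nwv.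
have [wNH _] := hyp_zpow _ N0 wH ltac:(lia).
have nwNv : ~ commute (zpow (e w) N0) (e v).
  by move=> /commute_sym/(commute_root _ N0 _ wH ltac:(lia))/commute_sym.
have [p [q []]] := twist_rigid (e v) (zpow (e w) N0) (e u) vH vC
  (noncommute_conj _ _ vH wNH nwNv) uH ltac:(lia).
set y := twist v (zpow w N0) p q.
have -> : (zpow (e v) p * (zpow (e w) N0 * zpow (e v) q * (zpow (e w) N0)^-1))%g = e y.
  by rewrite /y (hom_twist e v _ p q eM) (hom_zpow e w N0 eM).
move=> yH lvy yC yR /(_ luv) yI.
have Fy : F_valued y by apply: F_valued_twist.
have luy : trl (e u) < trl (e y) by lia.
have nuy : ~ commute (e u) (e y) by apply: short_noncommute1.
have [N1 N1_ge1 root'] := perturbed_power_root _ _ uH yH nuy.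
have [uNH _] := hyp_zpow _ N1 uH ltac:(lia).
have nuNy : ~ commute (zpow (e u) N1) (e y).
  by move=> /commute_sym/(commute_root _ N1 _ uH ltac:(lia))/commute_sym.
have [p' [q' []]] := twist_rigid (e y) (zpow (e u) N1) (e u) yH yC
  (noncommute_conj _ _ yH uNH nuNy) uH ltac:(lia).
set v' := twist y (zpow u N1) p' q'.
have -> : (zpow (e y) p' * (zpow (e u) N1 * zpow (e y) q' * (zpow (e u) N1)^-1))%g = e v'.
  by rewrite /v' (hom_twist e y _ p' q' eM) (hom_zpow e u N1 eM).
move=> v'H lyv' v'C v'R _.
exists v'; split=> //; [exact: F_valued_twist | by lia |].
move=> f fM fv'; have := v'R (f y) (zpow (f u) N1) (Fy f fM).
case=> [|i [fy fuN]]; first by rewrite -fv' /v' (hom_twist f y _ p' q' fM) (hom_zpow f u N1 fM).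
exists i; set c := zpow (e v') i in fy fuN *; rewrite /=.
pose f1 s := (c^-1 * f s * c^-1^-1)%g.
have f1M : hom f1 by apply: homJ.
have f1E s : f s = (c * f1 s * c^-1)%g by rewrite /f1; gsimp.
have f1y : f1 y = e y by rewrite /f1 fy; gsimp.
have [k f1uN] : exists k, zpow (f1 u) N1 = (zpow (e u) N1 * zpow (e y) k)%g.
  have [|k E] := yC ((zpow (e u) N1)^-1 * zpow (f1 u) N1)%g.
    apply: cosetP; apply: (@conj_inj c).
    by move: fuN; rewrite fy (f1E u) zpowJ; gsimp.
  by exists k; rewrite -E mulVKg.
clearbody f1; have fy1 : F (f1 v) by apply: Fv.
have [|m [f1v f1wN]] := yR (f1 v) (zpow (f1 w) N0) fy1.
  by rewrite -f1y /y (hom_twist f1 v _ p q f1M) (hom_zpow f1 w N0 f1M).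
set d := zpow (e y) m in f1v f1wN; pose f2 s := (d^-1 * f1 s * d^-1^-1)%g.
have f2M : hom f2 by apply: homJ.
have f2E s : f1 s = (d * f2 s * d^-1)%g by rewrite /f2; gsimp.
have f2v : f2 v = e v by rewrite /f2 f1v; gsimp.
clearbody f2.
have [l f2wN] : exists l, zpow (f2 w) N0 = (zpow (e w) N0 * zpow (e v) l)%g.
  have [|l E] := vC ((zpow (e w) N0)^-1 * zpow (f2 w) N0)%g.
    apply: cosetP; apply: (@conj_inj d).
    by move: f1wN; rewrite f1v (f2E w) zpowJ; gsimp.
  by exists l; rewrite -E mulVKg.
have [n f2S] := vR f2 f2M f2v; set a := zpow (e v) n in f2S.
have f2u := f2S u Su.
have f2uH : hyp (f2 u) by rewrite f2u; apply: hypJ.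
have f2ul : trl (f2 u) = trl (e u) by rewrite f2u trlJ.
have f2wE : f2 w = (f2 r * f2 u * (f2 r)^-1)%g by rewrite /w !f2M homV.
have f2w : f2 w = e w.
  apply: (root N0 _ _ l) => //; first lia.
    by rewrite f2wE; apply: hypJ.
  by rewrite f2wE trlJ // f2ul lw.
have f1u : f1 u = e u.
  apply: (root' N1 _ _ k) => //; first lia.
    by rewrite f2E; apply: hypJ.
  by rewrite f2E trlJ.
(* [f1 u = e u] says that [d * a], a power of [e y] times a power of [e v], centralizes [e u]; the
   exponents of the first twist allow this only for [m = 0]. *)
have m0 : m = 0.
  apply: (yI m n); rewrite -/d -/a; apply/commuteJP.
  by rewrite -{2}f1u f2E f2u; gsimp.
have d1 : d = 1%g by rewrite /d m0.
have n0 : n = 0.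
  have [//|n_neq0] := Z.eq_dec n 0; case: (short_noncommute1 _ _ vH vC uH luv).
  apply: (commute_root _ n) => //; rewrite -/a; apply/commute_sym/commuteJP.
  by rewrite -f2u -f1u f2E d1; gsimp.
have a1 : a = 1%g by rewrite /a n0.
have f1f2 s : f1 s = f2 s by rewrite f2E d1; gsimp.
by move=> s [Ss|->]; rewrite f1E f1f2 ?f2w // f2S // a1; gsimp.
Qed.

(** The centralizer of [e v] may exceed its powers; the twist [u] repairs this. Twisting [u] by [v]
    then records two non-commuting elements. *)
Lemma test_word_base v r : F_valued v -> hyp (e v) ->
  ~ commute (e v) (e r * e v * (e r)^-1)%g ->
  exists u w : W, [/\ F_valued u, hyp (e u),
    ~ commute (e u) (e (v * u * v^-1)%g) &
    test_word u w (fun s => s = u \/ s = (v * u * v^-1)%g)].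
Proof.
move=> Fv vH nc; have [p [q]] := twist_centralizer (e v) (e r) vH nc.
rewrite -(hom_twist e v r p q eM); set u := twist v r p q.
move=> [uH p0 q0 uC]; have Fu : F_valued u by apply: F_valued_twist.
have bH := hypJ (e r) (e v) vH.
have nvu : ~ commute (e v) (e u).
  move=> com; apply: nc; apply: (commute_root _ q) => //; rewrite zpowJ.
  have -> : (e r * zpow (e v) q * (e r)^-1 = (zpow (e v) p)^-1 * e u)%g.
    by rewrite /u (hom_twist e v r p q eM) mulKg.
  by apply: commuteM => //; apply/commuteV/commute_zpow.
clearbody u; have nc' := noncommute_conj _ _ uH vH nvu.
have [p' [q' []]] := twist_rigid (e u) (e v) (e u) uH uC nc' uH ltac:(lia).
rewrite -(hom_twist e u v p' q' eM); set w := twist u v p' q' => wH luw wC wR _.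
have euE : e (v * u * v^-1)%g = (e v * e u * (e v)^-1)%g by rewrite !eM homV.
exists u, w; split=> //; first by rewrite euE.
split=> //; first exact: F_valued_twist.
move=> f fM fw; have [|i [fu fv]] := wR (f u) (f v) (Fu f fM).
  by rewrite -fw /w (hom_twist f u v p' q' fM).
exists i => c s [->|->]; first exact: fu.
by rewrite euE !fM homV.
Qed.

(** The conjugates of [u] and [b] by [t i] fix [t i] modulo the common centralizer of [e u] and
    [e b], which is trivial. *)
Lemma rigid_tuple (k : nat) (t : 'I_k -> W) v r : F_valued v -> hyp (e v) ->
  ~ commute (e v) (e r * e v * (e r)^-1)%g ->
  exists w : W, forall f, hom f -> f w = e w ->
    exists c : G, forall i, f (t i) = (c * e (t i) * c^-1)%g.
Proof.
move=> Fv vH nc; have [u [w0 [Fu uH nub]]] := test_word_base v r Fv vH nc.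
set b := (v * u * v^-1)%g in nub * => w0P.
have [w [S [Su Sb St wP]]] : exists (w : W) S, [/\ S u, S b,
    forall i, S (t i * u * (t i)^-1)%g /\ S (t i * b * (t i)^-1)%g & test_word u w S].
  have : forall l : seq W, exists (w : W) S, [/\ S u, S b,
      forall x : W, x \in l -> S (x * u * x^-1)%g /\ S (x * b * x^-1)%g & test_word u w S].
    elim=> [|x l [w [S [Su Sb Sl wP]]]].
      by exists w0, (fun s => s = u \/ s = b); split=> //; [left | right].
    have [w1 w1P] := test_word_extend u w S x Fu uH Su wP.
    (* [b] is the conjugate of [u] by [v], so its conjugate by [x] is that of [u] by [x * v]. *)
    have [w2 w2P] := test_word_extend u w1 _ (x * v)%g Fu uH (or_introl Su) w1P.
    exists w2; eexists; split; last exact: w2P.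
    - by left; left.
    - by left; left.
    move=> y; rewrite inE => /orP[/eqP->|yl].
      by split; [left; right | right; rewrite /b; gsimp].
    by have [] := Sl y yl; split; left; left.
  move=> /(_ [seq t i | i : 'I_k])[w [S [Su Sb Sl wP]]]; exists w, S; split=> // i.
  by apply: Sl; apply/mapP; exists i; rewrite ?mem_enum.
clearbody b; exists w => f fM fw; have [_ _ _ _ wR] := wP.
have [n] := wR f fM fw; set c := zpow _ n => fS; exists c => i.
pose f1 s := (c^-1 * f s * c^-1^-1)%g.
have f1M : hom f1 by apply: homJ.
have f1S s : S s -> f1 s = e s by move=> /fS fs; rewrite /f1 fs; gsimp.
have f1t : f1 (t i) = e (t i).
  have [Stu Stb] := St i; apply: (mulgI (e (t i))^-1%g); rewrite mulVg.
  apply: (centralizer_pair (e u) (e b) _ uH nub); apply: cosetP.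
    have := f1S _ Stu; rewrite !f1M !eM (homV f1) // (homV e) //.
    by rewrite (f1S u Su).
  have := f1S _ Stb; rewrite !f1M !eM (homV f1) // (homV e) //.
  by rewrite (f1S b Sb).
by rewrite -f1t /f1; gsimp.
Qed.

End TestWords.

End Geometry.

Set Implicit Arguments.

(** * Free products *)

Section NormalForm.
Variables (I : choiceType) (H : I -> groupType).

Local Notation syl := {i : I & H i}.
Implicit Types (s t : syl) (w v : seq syl).

Definition smul s t : syl := Tagged H (tagged s * tagged_as s t).

Definition push s w : seq syl :=
  if tagged s == 1 then w else
  if w is t :: w' then
    if tag s == tag t then
      if tagged s * tagged_as s t == 1 then w' else smul s t :: w'
    else s :: w
  else [:: s].

Definition alternating (l : seq I) := sorted (fun i j => i != j) l.

Definition reduced w := all (fun s => tagged s != 1) w && alternating (map tag w).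

Lemma reduced_tail s w : reduced (s :: w) -> reduced w.
Proof. by rewrite /reduced /= => /andP[/andP[_ ->]] /path_sorted. Qed.

Lemma push_reduced s w : reduced w -> reduced (push s w).
Proof.
rewrite /push; case: eqP => // /eqP s_neq1; case: w => [|t w] w_red.
  by rewrite /reduced /= s_neq1.
case: ifPn => st; last first.
  by move: w_red; rewrite /reduced /= s_neq1 /= st.
case: eqP => [_|/eqP m_neq1]; first exact: reduced_tail w_red.
by move: w_red; rewrite /reduced /= m_neq1 (eqP st) /= => /andP[/andP[_ ->] ->].
Qed.

Lemma push1 s w : tagged s = 1 -> push s w = w.
Proof. by rewrite /push => ->; rewrite eqxx. Qed.

Lemma push_cons s w : reduced (s :: w) -> push s w = s :: w.
Proof.
rewrite /push /reduced /= => /andP[/andP[/negbTE -> _]].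
by case: w => //= t w /andP[/negbTE ->].
Qed.

Lemma push_same i (a b : H i) w : a != 1 ->
  push (Tagged H a) (Tagged H b :: w) =
    if a * b == 1 then w else Tagged H (a * b) :: w.
Proof. by rewrite /push /= eqxx /smul tagged_asE => /negbTE ->. Qed.

Lemma push_diff s t w : tagged s != 1 -> tag s != tag t ->
  push s (t :: w) = s :: t :: w.
Proof. by rewrite /push => /negbTE -> /negbTE ->. Qed.

Lemma push_nil s : tagged s != 1 -> push s [::] = [:: s].
Proof. by rewrite /push => /negbTE ->. Qed.

(* The syllables act on reduced sequences by [push] (van der Waerden's trick). *)
Lemma pushM i (a b : H i) w : reduced w ->
  push (Tagged H a) (push (Tagged H b) w) = push (Tagged H (a * b)) w.
Proof.
have [-> _|b_neq1] := eqVneq b 1; first by rewrite (@push1 (Tagged H 1)) ?mulg1.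
have [-> _|a_neq1] := eqVneq a 1; first by rewrite (@push1 (Tagged H 1)) ?mul1g.
have push_ab v : (push (Tagged H (a * b)) v =
    if a * b == 1 then v else push (Tagged H (a * b)) v).
  by case: eqP => // /(@push1 (Tagged H (a * b))) ->.
case: w => [|t w] w_red.
  by rewrite (@push_nil (Tagged H b)) // (@push_same i a).
have [it|it] := eqVneq i (tag t); last first.
  rewrite (@push_diff (Tagged H b)) // (@push_same i a) // push_ab.
  by have [//|ab] := eqVneq (a * b) 1; rewrite (@push_diff (Tagged H (a * b))).
case: t it w_red => j c /= ij; case: j / ij c => c w_red.
rewrite -[existT H i c]/(Tagged H c) in w_red *; rewrite (@push_same i b) //.
have [bc1|bc_neq1] := eqVneq (b * c) 1.
  have cb : c = b^-1 by rewrite -(mulKg b c) bc1 mulg1.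
  rewrite push_cons; last first.
    move: w_red; rewrite /reduced /= => /andP[/andP[_ ->] ->].
    by rewrite a_neq1.
  rewrite push_ab; case: eqP => [ab1|/eqP ab1].
    by rewrite cb -(mulgK b a) ab1 mul1g.
  by rewrite push_same // cb mulgK (negbTE a_neq1).
rewrite push_same // mulgA push_ab; have [ab1|ab1] := eqVneq (a * b) 1.
  rewrite ab1 mul1g; case: eqP => // c1.
  by move: w_red; rewrite /reduced /= c1 eqxx.
by rewrite push_same.
Qed.

Definition letter_value (l : syl * bool) : syl :=
  if l.2 then Tagged H (tagged l.1)^-1 else l.1.

Definition pushes (u : seq (syl * bool)) w := foldr (fun l => push (letter_value l)) w u.

Lemma pushes_reduced u w : reduced w -> reduced (pushes u w).
Proof. by move=> w_red; elim: u => //= l u; apply: push_reduced. Qed.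

Lemma pushes_eq (u v : word syl) w : reduced w -> word_eq (freeprod_rel (H := H)) u v ->
  pushes u w = pushes v w.
Proof.
move=> w_red uv; elim: uv w w_red => {u v} [//|u v _ IH w /IH //|||].
- by move=> u v v' _ IH1 _ IH2 w w_red; rewrite IH1 // IH2.
- move=> u l v w w_red; rewrite /pushes !foldr_cat /=; congr foldr.
  have v_red : reduced (pushes v w) by apply: pushes_reduced.
  case: l => -[i a] [] /=; rewrite /letter_value /=.
    by rewrite (pushM a^-1 a) // push1 //= mulVg.
  by rewrite (pushM a a^-1) // push1 //= mulgV.
move=> u s t v [i a b] w w_red; rewrite /pushes !foldr_cat /= /letter_value /=.
by rewrite pushM //; apply: pushes_reduced.
Qed.

Definition nf (x : freeprod H) : seq syl := pushes (repr x) [::].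

Lemma nf_reduced x : reduced (nf x). Proof. exact: pushes_reduced. Qed.

Lemma nf_class u : nf (word_class _ u) = pushes u [::].
Proof. by apply: pushes_eq => //; apply: repr_word_class. Qed.

Definition value w : freeprod H := word_class _ [seq (s, false) | s <- w].

Lemma value_cat w v : value (w ++ v) = value w * value v.
Proof. by rewrite /value map_cat; apply: word_class_cat. Qed.

Lemma value_cons s w : value (s :: w) = freeprod_in H (tag s) (tagged s) * value w.
Proof. by rewrite -cat1s value_cat; case: s. Qed.

Lemma value_nil : value [::] = 1. Proof. by []. Qed.

Lemma freeprod_in1 i : freeprod_in H i 1 = 1.
Proof.
by apply: (mulgI (freeprod_in H i 1)); rewrite -freeprod_in_is_multiplicative !mulg1.
Qed.

Lemma freeprod_inV i (a : H i) : freeprod_in H i a^-1 = (freeprod_in H i a)^-1.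
Proof.
apply: (mulgI (freeprod_in H i a)).
by rewrite -freeprod_in_is_multiplicative !mulgV freeprod_in1.
Qed.

Lemma value_push s w : value (push s w) = freeprod_in H (tag s) (tagged s) * value w.
Proof.
have [s1|s1] := eqVneq (tagged s) 1; first by rewrite push1 // s1 freeprod_in1 mul1g.
case: w => [|t w]; first by rewrite push_nil // value_cons.
have [st|st] := eqVneq (tag s) (tag t); last by rewrite push_diff // value_cons.
case: s t st s1 => i a [j b] /= ij; case: j / ij b => b a1.
rewrite -[existT H i a]/(Tagged H a) -[existT H i b]/(Tagged H b) push_same //.
rewrite value_cons /= mulgA -freeprod_in_is_multiplicative.
by case: eqP => [->|_]; rewrite ?value_cons // freeprod_in1 mul1g.
Qed.

Lemma nfK x : value (nf x) = x.
Proof.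
rewrite -{2}(word_classK x) /nf; elim: (repr x) => [//|l u IHu].
rewrite -cat1s word_class_cat /= value_push {}IHu; congr (_ * _).
case: l => -[i a] [] //=.
rewrite /letter_value /= freeprod_inV.
apply: (mulgI (freeprod_in H i a)); rewrite mulgV.
apply/esym; rewrite -[LHS]word_class_cat; apply/word_classP.
exact: (@WordCancel _ _ [::] (existT H i a, false) [::]).
Qed.

Lemma valueK w : reduced w -> nf (value w) = w.
Proof.
rewrite nf_class; elim: w => //= s w IHw sw_red.
by rewrite IHw ?(reduced_tail sw_red) // push_cons.
Qed.

Lemma nf1 : nf 1 = [::]. Proof. exact: (@valueK [::]). Qed.

Definition sinv s : syl := Tagged H (tagged s)^-1.

Definition winv w := rev (map sinv w).

Lemma tag_winv w : map tag (winv w) = rev (map tag w).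
Proof. by rewrite /winv map_rev -map_comp. Qed.

Lemma value_winv w : value (winv w) = (value w)^-1.
Proof.
elim: w => [|s w IHw]; first by rewrite value_nil invg1.
rewrite /winv /= rev_cons -cats1 value_cat -/(winv w) IHw !value_cons mulg1.
by rewrite freeprod_inV invgM.
Qed.

Lemma alternating_rev l : alternating (rev l) = alternating l.
Proof.
rewrite /alternating rev_sorted; case: l => //= i l.
by elim: l i => //= j l IHl i; rewrite IHl eq_sym.
Qed.

Lemma winv_reduced w : reduced (winv w) = reduced w.
Proof.
rewrite /reduced tag_winv alternating_rev; congr (_ && _).
rewrite all_rev all_map; apply: eq_all => s /=.
by rewrite invg_eq1.
Qed.

Lemma alternating_cat l i l' :
  alternating (l ++ i :: l') = alternating (rcons l i) && alternating (i :: l').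
Proof. exact: sorted_cat_cons. Qed.

(* Twice the length of the common initial segment in the Bass-Serre tree: after the
   shared syllables, two distinct syllables of the same factor merge into one in the
   quotient, hence count for one. *)
Fixpoint common w v : nat :=
  match w, v with
  | s :: w', t :: v' =>
    if s == t then (common w' v').+2 else (tag s == tag t)
  | _, _ => 0
  end.

Lemma reduced_cat_cons w s v :
  reduced (w ++ s :: v) = reduced (rcons w s) && reduced (s :: v).
Proof.
rewrite /reduced map_cat /= alternating_cat map_rcons all_cat all_rcons /=.
by case: (tagged s != 1); case: (all _ w); case: (all _ v); rewrite ?andbF ?andbT.
Qed.

Lemma size_winv w : size (winv w) = size w.
Proof. by rewrite size_rev size_map. Qed.

Lemma winv_cons s w : winv (s :: w) = rcons (winv w) (sinv s).
Proof. by rewrite /winv /= rev_cons. Qed.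

Lemma reduced_rcons_tag w s t : tag s = tag t -> tagged t != 1 ->
  reduced (rcons w s) -> reduced (rcons w t).
Proof.
move=> st t1; rewrite /reduced !map_rcons !all_rcons t1 => /andP[/andP[_ ->]].
by rewrite st.
Qed.

Lemma reduced_cons_tag w s t : tag s = tag t -> tagged t != 1 ->
  reduced (s :: w) -> reduced (t :: w).
Proof.
by move=> st t1; rewrite /reduced /= t1 => /andP[/andP[_ ->]]; rewrite st.
Qed.

Lemma size_nf_div w v : reduced w -> reduced v ->
  size (nf ((value w)^-1 * value v)) + common w v = size w + size v.
Proof.
elim: w v => [|s w IHw] [|t v] w_red v_red.
- by rewrite value_nil invg1 mulg1 nf1.
- by rewrite value_nil invg1 mul1g valueK // addn0.
- by rewrite value_nil mulg1 -value_winv valueK ?winv_reduced // size_winv.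
rewrite [common _ _]/=; have [->|st] := eqVneq s t.
  rewrite !value_cons invgM mulgA mulgVK !addnS IHw ?addSn ?addnS //.
    exact: reduced_tail w_red.
  exact: reduced_tail v_red.
rewrite -winv_reduced winv_cons in w_red.
have [tst|tst] := eqVneq (tag s) (tag t); last first.
  rewrite -value_winv -value_cat valueK ?winv_cons.
    by rewrite size_cat size_rcons size_winv addn0.
  rewrite reduced_cat_cons v_red andbT /reduced !map_rcons all_rcons /=.
  move: w_red v_red; rewrite /reduced map_rcons => /andP[nt alt] /= /andP[/andP[-> _] _].
  rewrite nt /=; rewrite /alternating.
  case: (map tag (winv w)) alt => [|i l]; rewrite /alternating /= ?tst //.
  by rewrite !rcons_path /= last_rcons tst andbT => ->.
case: s t st tst w_red v_red => i a [j b] + /= ij.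
case: j / ij b => b; rewrite -[existT H i a]/(Tagged H a) -[existT H i b]/(Tagged H b).
rewrite eq_Tagged /= => ab w_red v_red.
have -> : (value (Tagged H a :: w))^-1 * value (Tagged H b :: v)
    = value (winv w ++ Tagged H (a^-1 * b) :: v).
  rewrite value_cat value_winv !value_cons invgM /= freeprod_in_is_multiplicative.
  by rewrite freeprod_inV !mulgA.
have nt : a^-1 * b != 1.
  by apply: contra_neq ab => E; rewrite -(mulVKg a b) E mulg1.
rewrite valueK; first by rewrite size_cat size_winv /= addn1 addSn addnS.
rewrite reduced_cat_cons (@reduced_rcons_tag _ (sinv (Tagged H a))) //.
exact: (@reduced_cons_tag _ (Tagged H b)).
Qed.

End NormalForm.

(** * The tree metric of a free product *)

Section Length.
Variables (I : choiceType) (H : I -> groupType).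
Local Notation syl := {i : I & H i}.
Local Notation FP := (freeprod H).
Implicit Types (s t : syl) (u v w : seq syl) (x y z : FP).

Lemma commonC w v : common w v = common v w.
Proof.
elim: w v => [|s w IHw] [|t v] //=; rewrite IHw [t == s]eq_sym.
by rewrite [tag t == _]eq_sym.
Qed.

Lemma common_ultrametric u v w : minn (common u v) (common v w) <= common u w.
Proof.
elim: u v w => [|s u IHu] [|t v] [|r w] //=; rewrite ?(minn0, min0n) //.
have [->|st] := eqVneq s t.
  by have [_|tr] := eqVneq t r; rewrite ?geq_minr ?minnSS ?ltnS.
have [<-|tr] := eqVneq t r; first by rewrite (negbTE st) geq_minl.
have [<-|sr] := eqVneq s r.
  by apply: leq_trans (geq_minl _ _) _; case: (_ == _).
by case: eqP => [->|_]; rewrite ?geq_minr // min0n.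
Qed.

Definition len x : Z := Z.of_nat (size (nf x)).

Local Notation dist x y := (len (x^-1 * y)).

Lemma len_ge0 x : (0 <= len x)%Z. Proof. exact: Nat2Z.is_nonneg. Qed.

Lemma len1 : len 1 = 0%Z. Proof. by rewrite /len nf1. Qed.

Lemma len0_eq1 x : len x = 0%Z -> x = 1.
Proof.
by rewrite /len -{2}(nfK x); case: (nf x).
Qed.

Lemma len_div x y :
  (len (x^-1 * y) + Z.of_nat (common (nf x) (nf y)) = len x + len y)%Z.
Proof.
have := size_nf_div (nf_reduced x) (nf_reduced y); rewrite !nfK /len -!plusE; lia.
Qed.

Lemma lenV x : len x^-1 = len x.
Proof.
by rewrite /len -{1}(nfK x) -value_winv valueK ?winv_reduced ?nf_reduced // size_winv.
Qed.

(** After translating [w'] to [1], [common] is twice the Gromov product, and its ultrametric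
    inequality is the four-point condition. *)
Lemma len_four_point x y z (w' : FP) :
  (dist x y + dist z w' <=
     Z.max (dist x z + dist y w') (dist x w' + dist y z))%Z.
Proof.
have distJ a b c : dist a b = dist (c^-1 * a) (c^-1 * b).
  by gsimp.
have len_dist a : dist a w' = len (w'^-1 * a) by rewrite  -lenV; gsimp.
rewrite (distJ x y w') (distJ x z w') (distJ y z w') !len_dist .
set a := w'^-1 * x; set b := w'^-1 * y; set c := w'^-1 * z.
have := len_div a b; have := len_div a c; have := len_div b c.
have := common_ultrametric (nf a) (nf c) (nf b).
rewrite (commonC (nf c)) geq_min => /orP[] /leP; lia.
Qed.

Lemma size_nf_value w : size (nf (value w)) <= size w.
Proof.
rewrite nf_class; elim: w => //= s w; move: (pushes _ _) => v IHw.
have: size (push s v) <= (size v).+1.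
  rewrite /push; case: eqP => _ //; case: v {IHw} => //= t v.
  by case: eqP => // _; case: eqP => //= _; rewrite ltnW.
by move/leq_trans; apply.
Qed.

(** [tagged_as] falls back on its first argument when the tags differ, so other factors go to
    [1]. *)
Definition component (i : I) (j : I) (a : H j) : H i :=
  tagged_as (Tagged H (1 : H i)) (Tagged H a).

Lemma component_id i (a : H i) : component i a = a.
Proof. exact: (@tagged_asE _ _ (Tagged H (1 : H i)) a). Qed.

Lemma component_neq i j (a : H j) : i != j -> component i a = 1.
Proof. by rewrite /component /tagged_as; case: eqP. Qed.

Lemma componentM i j : {morph @component i j : a b / a * b}.
Proof.
move=> a b; have [ij|ij] := eqVneq i j; last by rewrite !component_neq ?mulg1.
by case: j / ij a b => a b; rewrite !component_id.
Qed.

Definition retraction i : FP -> H i := freeprod_lift (@component i).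

Lemma retractionM i : {morph retraction i : x y / x * y}.
Proof. exact/freeprod_lift_is_multiplicative/componentM. Qed.

Lemma retraction_in i (a : H i) : retraction i (freeprod_in H i a) = a.
Proof. by rewrite /retraction freeprod_lift_in ?component_id //; apply: componentM. Qed.

(* Membership in the kernel of the map to the direct product of the factors, which
   meets every conjugate of a factor trivially. *)
Definition cartesian x := forall i, retraction i x = 1.

Lemma retraction1 i : retraction i 1 = 1.
Proof. by apply: (mulgI (retraction i 1)); rewrite -retractionM !mulg1. Qed.

Lemma retractionV i x : retraction i x^-1 = (retraction i x)^-1.
Proof.
by apply: (mulgI (retraction i x)); rewrite -retractionM !mulgV retraction1.
Qed.

Lemma cartesianM x y : cartesian x -> cartesian y -> cartesian (x * y).
Proof. by move=> x1 y1 i; rewrite retractionM x1 y1 mulg1. Qed.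

Lemma cartesianV x : cartesian x -> cartesian x^-1.
Proof. by move=> x1 i; rewrite retractionV x1 invg1. Qed.

Lemma cartesianJ x (t : FP) : cartesian x -> cartesian (t * x * t^-1).
Proof. by move=> x1 i; rewrite !retractionM x1 mulg1 -retractionM mulgV retraction1. Qed.

Lemma value_rcons w s :
  value (rcons w s) = value w * freeprod_in H (tag s) (tagged s).
Proof. by rewrite -cats1 value_cat value_cons value_nil mulg1. Qed.

(** A shortest conjugate has at least two syllables, as a retraction detects a single one. Its ends
    lie in different factors, or conjugating by the first syllable would shorten it; hence its
    square is reduced as written. *)
Lemma cartesian_hyp x : cartesian x -> x <> 1 -> hyp FP len x.
Proof.
move=> x_cart x_neq1; split=> //.
have ex_size : exists n, `[< exists y, size (nf (y^-1 * x * y)) = n >].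
  by exists (size (nf (1^-1 * x * 1))); apply/asboolP; exists 1.
case: (ex_minnP ex_size) => n /asboolP[y size_y] n_min; exists y.
have {}n_min y' : n <= size (nf (y'^-1 * x * y')).
  by apply: n_min; apply/asboolP; exists y'.
pose x' := y^-1 * x * y; have x'_cart : cartesian x'.
  by rewrite /x' -{2}[y]invgK; apply: cartesianJ.
rewrite /axial; have -> : y^-1 * (x * x * y) = x' * x' by rewrite /x'; gsimp.
have -> : y^-1 * (x * y) = x' by rewrite /x'; gsimp.
rewrite -/x' in size_y; have x'_neq1 : x' <> 1.
  move=> x'1; apply: x_neq1; move: x'1; rewrite /x' => /(congr1 (fun z => y * z * y^-1)).
  by gsimp.
have n_min' y' : n <= size (nf (y'^-1 * x' * y')).
  by have := n_min (y * y'); rewrite /x'; gsimp.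
move: (nf_reduced x') (nfK x') size_y; case: (nf x') => [|s w] w_red xE.
  by case: x'_neq1; rewrite -xE.
case: (lastP w) w_red xE => [|u t] w_red xE size_x'.
  case: s w_red xE {size_x'} => i a w_red xE; have := x'_cart i.
  rewrite -xE value_cons value_nil mulg1 retraction_in => /= a1.
  by move: w_red; rewrite /reduced /= a1 eqxx.
have [st|st] := eqVneq (tag t) (tag s).
  case: s t st w_red xE size_x' => i a [j b] /= ij; case: i / ij a => a w_red xE size_x'.
  have := n_min' (freeprod_in H j a).
  have -> : (freeprod_in H j a)^-1 * x' * freeprod_in H j a
       = value (rcons u (Tagged H (b * a))).
    rewrite -xE value_cons !value_rcons /= freeprod_in_is_multiplicative.
    by gsimp.
  move/leq_trans/(_ (size_nf_value _)); rewrite -size_x' /= !size_rcons.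
  by rewrite ltnn.
have xx_red : reduced ((s :: rcons u t) ++ s :: rcons u t).
  rewrite reduced_cat_cons w_red andbT -rcons_cons.
  move: w_red; rewrite /reduced !map_rcons !all_rcons /= => /andP[/and3P[-> -> ->]] /=.
  by rewrite /alternating /= !rcons_path last_rcons => ->.
rewrite /len -xE -value_cat !valueK // size_cat -plusE; lia.
Qed.
End Length.

(** * Laws and free subgroups *)

Section FreeWords.
Variable T : choiceType.
Implicit Types (u v w : word T) (l m : T * bool).

Definition free_reduced u := sorted (fun l m => m != inv_letter l) u.

Section Evaluation.
Variables (G : groupType) (phi : T -> G).

Lemma eval_word_nil : eval_word phi [::] = 1.
Proof. exact: big_nil. Qed.

Lemma eval_word_cons l u : eval_word phi (l :: u) = eval_letter phi l * eval_word phi u.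
Proof. exact: big_cons. Qed.

Lemma eval_word_cat u v : eval_word phi (u ++ v) = eval_word phi u * eval_word phi v.
Proof. exact: big_cat. Qed.

Lemma eval_inv_letter l : eval_letter phi (inv_letter l) = (eval_letter phi l)^-1.
Proof. by case: l => t []; rewrite /eval_letter /= ?invgK. Qed.

Lemma eval_inv_word u : eval_word phi (inv_word u) = (eval_word phi u)^-1.
Proof.
elim: u => [|l u IHu]; first by rewrite eval_word_nil invg1.
rewrite /inv_word /= rev_cons -cats1 eval_word_cat -/(inv_word u) IHu.
by rewrite !eval_word_cons eval_word_nil mulg1 eval_inv_letter invgM.
Qed.

End Evaluation.

Lemma morph_eval_word (G K : groupType) (f : G -> K) (phi : T -> G) u :
  {morph f : x y / x * y} -> f (eval_word phi u) = eval_word (f \o phi) u.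
Proof.
move=> fM; have f1 : f 1 = 1 by apply: (mulgI (f 1)); rewrite -fM !mulg1.
have fV x : f x^-1 = (f x)^-1 by apply: (mulgI (f x)); rewrite -fM !mulgV.
elim: u => [|l u IHu]; first by rewrite !eval_word_nil.
by rewrite !eval_word_cons fM IHu; case: l => t []; rewrite /eval_letter /= ?fV.
Qed.

Lemma eq_eval_word (G : groupType) (phi psi : T -> G) u :
  {in u, forall l, phi l.1 = psi l.1} -> eval_word phi u = eval_word psi u.
Proof.
move=> eq_phi; apply: eq_big_seq => l lu; rewrite /eval_letter.
by rewrite eq_phi.
Qed.

Lemma free_reductionP u : exists2 v, free_reduced v &
  forall (G : groupType) (phi : T -> G), eval_word phi v = eval_word phi u.
Proof.
elim: u => [|l u [v v_red vE]]; first by exists [::].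
case: v v_red vE => [|m v] v_red vE.
  by exists [:: l] => // G phi; rewrite !eval_word_cons -vE.
have [ml|ml] := eqVneq m (inv_letter l).
  exists v => [|G phi]; first exact: path_sorted v_red.
  by rewrite eval_word_cons -vE eval_word_cons ml eval_inv_letter mulVKg.
by exists [:: l, m & v] => [|G phi]; rewrite ?eval_word_cons -?vE ?eval_word_cons //= ml.
Qed.

Lemma free_reduced_inv u : free_reduced (inv_word u) = free_reduced u.
Proof.
rewrite /free_reduced /inv_word rev_sorted sorted_map.
case: u => //= k u; apply: eq_path => l m /=.
by rewrite inv_letterK eq_sym.
Qed.

Lemma eval_word_pgen R u : eval_word (pgen R) u = word_class R u.
Proof.
elim: u => [|l u IHu]; first by rewrite eval_word_nil.
rewrite eval_word_cons IHu -cat1s word_class_cat; congr (_ * _).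
case: l => t [] //; apply: (mulgI (pgen R t)).
rewrite mulgV -[RHS]word_class_cat; apply/word_classP/WordSym.
exact: (@WordCancel _ _ [::] (t, false) [::]).
Qed.

Definition apart u v := all (fun l => all (fun m => l.1 != m.1) v) u.

Lemma apartC u v : apart u v = apart v u.
Proof.
apply/allP/allP => uv l lu; apply/allP => m mv; rewrite eq_sym;
exact: (allP (uv m mv)).
Qed.

Lemma apart_invl u v : apart (inv_word u) v = apart u v.
Proof. by rewrite /apart /inv_word all_rev all_map. Qed.

Lemma apart_invr u v : apart u (inv_word v) = apart u v.
Proof. by rewrite apartC apart_invl apartC. Qed.

Lemma free_reduced_flatten (bs : seq (word T)) :
  all (fun b => (b != [::]) && free_reduced b) bs -> sorted apart bs ->
  free_reduced (flatten bs).
Proof.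
elim: bs => //= b bs IHbs /andP[/andP[b_neq0 b_red] bs_red] bbs.
have {IHbs} := IHbs bs_red (path_sorted bbs).
case: bs bs_red bbs => [|b' bs] /=; first by rewrite cats0.
case: b b_neq0 b_red => // l u _ u_red; case: b' => [|m v] //= _ /andP[lm _] mv_red.
rewrite /free_reduced /= cat_path /= mv_red andbT; apply/andP; split => //.
have /andP[+ _] := allP (lm : apart (l :: u) (m :: v)) _ (mem_last l u).
by apply: contra => /eqP ->.
Qed.

End FreeWords.

Section CommonLaw.
Implicit Types (u v w : word nat) (l m : nat * bool).

Definition law_word (G : groupType) u := forall phi : nat -> G, eval_word phi u = 1.

Definition letters_below N u := all (fun l => l.1 < N) u.

Lemma letters_belowP u : exists N, letters_below N u.
Proof.
elim: u => [|l u [N uN]]; first by exists 0.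
exists (maxn l.1.+1 N); rewrite /letters_below /= leq_max leqnn /=.
by apply: sub_all uN => m mN; rewrite leq_max mN orbT.
Qed.

Lemma nontrivial_law_word (G : groupType) : satisfies_nontrivial_law G ->
  exists u, [/\ u != [::], free_reduced u & law_word G u].
Proof.
case=> r [w [w_neq1 w_law]].
have [v v_red vE] := free_reductionP (repr w).
exists [seq (val k.1, k.2) | k <- v]; split.
- apply: contra_notN w_neq1; case: v v_red vE => // _ vE _.
  by rewrite -(word_classK w) -eval_word_pgen -vE eval_word_nil.
- rewrite /free_reduced sorted_map; apply: sub_sorted v_red => -[i a] [j b] /=.
  by apply: contra => /eqP[/val_inj -> ->].
move=> phi; have := w_law (phi \o val); rewrite /free_eval /plift -vE => <-.
by rewrite /eval_word big_map; apply: eq_bigr => -[].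
Qed.

Lemma commutator_law_word (G : groupType) u v : law_word G u \/ law_word G v ->
  law_word G (u ++ v ++ inv_word u ++ inv_word v).
Proof.
move=> uv phi; rewrite !eval_word_cat !eval_inv_word.
by case: uv => ->; gsimp.
Qed.

(** The commutator of a law of one group with a law of another is a law in both. Shifting the
    letters of one makes it reduced as written, hence non-trivial. *)
Lemma common_law_word (I : eqType) (H : I -> groupType) (s : seq I) :
  (forall i, satisfies_nontrivial_law (H i)) ->
  exists u, [/\ u != [::], free_reduced u & {in s, forall i, law_word (H i) u}].
Proof.
move=> H_law; elim: s => [|i s [u [u_neq0 u_red u_law]]].
  by exists [:: (0, false)].
have [v [v_neq0 v_red v_law]] := nontrivial_law_word (H_law i).
have [N uN] := letters_belowP u; pose v' := [seq (l.1 + N, l.2) | l <- v].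
have uv' : apart u v'.
  apply/allP=> l /(allP uN) lN; rewrite all_map; apply/allP=> m _ /=.
  by rewrite neq_ltn (leq_trans lN) // leq_addl.
have v'_neq0 : v' != [::] by case: v v_neq0 {v_red v_law uv'} @v'.
have inv_neq0 w : w != [::] -> inv_word w != [::].
  by rewrite -!size_eq0 size_rev size_map.
have v'_red : free_reduced v'.
  rewrite /free_reduced sorted_map; apply: sub_sorted v_red => l [k a] /=.
  by apply: contra => /eqP[/addIn -> ->].
have v'_law : law_word (H i) v'.
  move=> phi; rewrite -(v_law (fun k => phi (k + N))) /eval_word big_map.
  by apply: eq_bigr.
exists (u ++ v' ++ inv_word u ++ inv_word v'); split.
- by case: (u) u_neq0.
- have := @free_reduced_flatten _ [:: u; v'; inv_word u; inv_word v'].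
  rewrite /= cats0; apply; rewrite ?free_reduced_inv.
    by rewrite u_neq0 v'_neq0 !inv_neq0 // u_red v'_red.
  by rewrite !apart_invr apart_invl uv' apartC uv'.
move=> j; rewrite inE => /orP[/eqP ->|js]; apply: commutator_law_word.
  by right.
by left; apply: u_law.
Qed.

End CommonLaw.

(* In a free product, [T] holds for the elements whose normal form starts with a
   syllable of the factor of [b]. *)
Section PingPong.
Variables (G : groupType) (T : G -> bool) (b c1 c2 : G).
Hypotheses (T1 : ~~ T 1)
  (Tb : forall x, ~~ T x -> T (b * x)) (TbV : forall x, ~~ T x -> T (b^-1 * x))
  (Tc1 : forall x, T x -> ~~ T (c1 * x)) (Tc1V : forall x, T x -> ~~ T (c1^-1 * x))
  (Tc2 : forall x, T x -> ~~ T (c2 * x)) (Tc2V : forall x, T x -> ~~ T (c2^-1 * x))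
  (Tc12 : forall x, T x -> ~~ T (c1^-1 * (c2 * x)))
  (Tc21 : forall x, T x -> ~~ T (c2^-1 * (c1 * x))).

Definition tooth (k : nat) : G := (b * c1) ^+ k * (b * c2).

(** The ends are teeth of different indices. Where letters that are not mutually inverse meet, two
    different teeth meet and cancel only until [c1] faces [c2], so each core [b * c1 * b] or its
    inverse survives. *)
Definition schottky (l : nat) : G := tooth l.*2 * (b * c1 * b) * (tooth l.*2.+1)^-1.

Lemma T_pow k x : T x -> T ((b * c1) ^+ k * x).
Proof.
move=> Tx; elim: k => [|k IHk]; first by rewrite mul1g.
by rewrite expgS -!mulgA Tb // Tc1.
Qed.

Lemma T_powV k x : ~~ T x -> ~~ T ((b * c1) ^- k * x).
Proof.
move=> Tx; elim: k => [|k IHk]; first by rewrite invg1 mul1g.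
by rewrite expgSr invgM -!mulgA invgM -mulgA Tc1V ?TbV.
Qed.

Lemma T_tooth k x : T x -> T (tooth k * x).
Proof. by move=> Tx; rewrite /tooth -!mulgA T_pow // Tb // Tc2. Qed.

Lemma T_toothV k x : ~~ T x -> ~~ T ((tooth k)^-1 * x).
Proof. by move=> Tx; rewrite /tooth invgM invgM -!mulgA Tc2V // TbV // T_powV. Qed.

Lemma T_tooth_neq k k' x : k != k' -> T x -> ~~ T ((tooth k)^-1 * (tooth k' * x)).
Proof.
move=> kk' Tx; rewrite /tooth !invgM -!mulgA.
have [lt_kk'|lt_k'k|eq_kk'] := ltngtP k k'; last by rewrite eq_kk' eqxx in kk'.
  rewrite -(subnKC (ltnW lt_kk')) expgnDr -!mulgA mulKg.
  rewrite -(prednK (_ : 0 < k' - k)) ?subn_gt0 // expgS -!mulgA mulKg.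
  by rewrite Tc21 // T_pow // Tb // Tc2.
rewrite -(subnKC (ltnW lt_k'k)) expgnDr invgM -!mulgA mulKg.
rewrite -(prednK (_ : 0 < k - k')) ?subn_gt0 // expgS !invgM -!mulgA mulKg.
by rewrite Tc2V // TbV // T_powV // Tc12.
Qed.

(* Each letter starts with its own tooth and ends with the inverse of the tooth of the
   inverse letter. *)
Definition start (l : nat * bool) := l.1.*2 + l.2.

Lemma start_inj : injective start.
Proof.
move=> [l a] [m c]; rewrite /start /= => lm; congr (_, _).
  by have := congr1 half lm; rewrite ![_.*2 + _]addnC !half_bit_double.
by have := congr1 odd lm; rewrite !oddD !odd_double !oddb.
Qed.

Lemma eval_schottky l x : exists2 y, forall z, ~~ T z -> T (y * z) &
  eval_letter schottky l * x = tooth (start l) * (y * ((tooth (start (inv_letter l)))^-1 * x)).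
Proof.
case: l => l [] /=; rewrite /eval_letter /schottky /start /= ?addn0 ?addn1.
  exists (b^-1 * c1^-1 * b^-1) => [z Tz|]; last by gsimp.
  by rewrite -!mulgA TbV // Tc1V // TbV.
exists (b * c1 * b) => [z Tz|]; last by gsimp.
by rewrite -!mulgA Tb // Tc1 // Tb.
Qed.

Lemma schottky_free u : free_reduced u -> u != [::] -> eval_word schottky u != 1.
Proof.
move=> u_red u_neq0; suff: T (eval_word schottky u).
  by apply: contraTneq => ->.
suff [l [v [z [_ Tz ->]]]] : exists l v z,
    [/\ u = l :: v, T z & eval_word schottky u = tooth (start l) * z].
  exact: T_tooth.
elim: u u_red u_neq0 => // l u IHu u_red _; exists l, u; rewrite eval_word_cons.
have [y Ty ->] := eval_schottky l (eval_word schottky u); eexists; split => //.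
apply: Ty; case: u u_red IHu => [|m u] u_red IHu.
  by rewrite eval_word_nil T_toothV.
have [_ [_ [z [[<- _] Tz ->]]]] := IHu (path_sorted u_red) isT.
apply: T_tooth_neq => //; rewrite (inj_eq start_inj) eq_sym.
by have /andP[] := u_red.
Qed.

End PingPong.

Section FreeSubgroup.
Variables (I : choiceType) (H : I -> groupType).
Local Notation syl := {i : I & H i}.
Local Notation FP := (freeprod H).

Definition starts_with (i : I) (x : FP) : bool :=
  if nf x is s :: _ then tag s == i else false.

Lemma starts_with_inj i j x : starts_with i x -> starts_with j x -> i = j.
Proof. by rewrite /starts_with; case: (nf x) => // s _ /eqP <- /eqP. Qed.

Lemma starts_with1 i : ~~ starts_with i 1.
Proof. by rewrite /starts_with nf1. Qed.

Lemma nf_in_mul i (a : H i) x : nf (freeprod_in H i a * x) = push (Tagged H a) (nf x).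
Proof.
rewrite -{1}(word_classK x) -[_ * _]word_class_cat nf_class.
by [].
Qed.

Lemma starts_with_in_mul i (a : H i) x :
  a <> 1 -> ~~ starts_with i x -> starts_with i (freeprod_in H i a * x).
Proof.
move=> /eqP a_neq1; rewrite /starts_with nf_in_mul.
case: (nf x) => [_|s w si]; first by rewrite push_nil //=.
by rewrite push_diff //= eq_sym.
Qed.

Definition syl_in (s : syl) : FP := freeprod_in H (tag s) (tagged s).

Lemma syl_in_V (s : syl) : (syl_in s)^-1 = freeprod_in H (tag s) (tagged s)^-1.
Proof. by rewrite freeprod_inV. Qed.

Lemma neq1_inv (G : groupType) (x : G) : x <> 1 -> x^-1 <> 1.
Proof. by apply: contra_not => /eqP; rewrite invg_eq1 => /eqP. Qed.

Lemma not_starts_with_in_mul i j (a : H i) x :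
  a <> 1 -> i != j -> starts_with j x -> ~~ starts_with j (freeprod_in H i a * x).
Proof.
move=> a_neq1 ij jx; apply/negP=> /starts_with_inj/(_ (starts_with_in_mul a_neq1 _)) ji.
have/eqP[] := ij; rewrite ji //; apply: contraNN ij => /starts_with_inj/(_ jx) ->.
exact: eqxx.
Qed.

Lemma not_starts_with_div j (s t : syl) x : tagged s <> 1 -> tagged t <> 1 ->
  tag s != j -> tag t != j -> s <> t ->
  starts_with j x -> ~~ starts_with j ((syl_in s)^-1 * (syl_in t * x)).
Proof.
rewrite syl_in_V mulgA => s1 t1 sj tj st jx.
have [ts|ts] := eqVneq (tag t) (tag s).
  case: s t ts s1 t1 sj tj st => i a [k c] /= ik; case: i / ik a => a a1 c1 kj _ ac.
  rewrite /syl_in /= -freeprod_in_is_multiplicative not_starts_with_in_mul // => E.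
  by case: ac; congr existT; rewrite -(mulVKg a c) E mulg1.
have ts' : starts_with (tag t) (syl_in t * x).
  apply: starts_with_in_mul => //; apply: contraNN tj => /starts_with_inj/(_ jx) ->.
  exact: eqxx.
rewrite -mulgA.
have: starts_with (tag s) (freeprod_in H (tag s) (tagged s)^-1 * (syl_in t * x)).
  apply: starts_with_in_mul; first exact: neq1_inv.
  by apply: contraNN ts => /starts_with_inj/(_ ts') ->.
by move=> ss; apply: contraNN sj => /starts_with_inj/(_ ss) ->.
Qed.

Lemma freeprod_schottky j (b : H j) (s1 s2 : syl) u :
  b <> 1 -> tagged s1 <> 1 -> tagged s2 <> 1 ->
  tag s1 != j -> tag s2 != j -> s1 <> s2 -> free_reduced u -> u != [::] ->
  eval_word (schottky (freeprod_in H j b) (syl_in s1) (syl_in s2)) u != 1.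
Proof.
move=> b_neq1 s1_neq1 s2_neq1 s1_neqj s2_neqj s12.
apply: (@schottky_free _ (starts_with j)); first exact: starts_with1.
- by move=> x; apply: starts_with_in_mul.
- by move=> x; rewrite -freeprod_inV; apply: starts_with_in_mul; apply: neq1_inv.
- by move=> x; apply: not_starts_with_in_mul.
- by move=> x; rewrite syl_in_V; apply: not_starts_with_in_mul => //; apply: neq1_inv.
- by move=> x; apply: not_starts_with_in_mul.
- by move=> x; rewrite syl_in_V; apply: not_starts_with_in_mul => //; apply: neq1_inv.
- by move=> x; apply: not_starts_with_div.
- by move=> x; apply: not_starts_with_div => // /esym.
Qed.

End FreeSubgroup.

Lemma freeprod_hom_eq (I : choiceType) (H : I -> groupType) (G : groupType)
    (f f' : freeprod H -> G) :
  {morph f : x y / x * y} -> {morph f' : x y / x * y} ->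
  (forall i (a : H i), f (freeprod_in H i a) = f' (freeprod_in H i a)) -> f =1 f'.
Proof.
move=> fM f'M ff' x; rewrite -(nfK x); elim: (nf x) => [|s w IHw].
  rewrite value_nil; transitivity (1 : G); last apply/esym.
    by apply: (mulgI (f 1)); rewrite -fM !mulg1.
  by apply: (mulgI (f' 1)); rewrite -f'M !mulg1.
by rewrite value_cons fM f'M IHw ff'.
Qed.

Section FreeProductMap.
Variables (I J : choiceType) (H : I -> groupType) (K : J -> groupType).
Variables (s : I -> J) (phi : forall i, H i -> K (s i)).
Hypothesis phiM : forall i, {morph @phi i : a b / a * b}.

Definition freeprod_map : freeprod H -> freeprod K :=
  freeprod_lift (fun i a => freeprod_in K (s i) (phi a)).

Let mapM i : {morph (fun a => freeprod_in K (s i) (@phi i a)) : a b / a * b}.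
Proof. by move=> a b; rewrite phiM freeprod_in_is_multiplicative. Qed.

Lemma freeprod_mapM : {morph freeprod_map : x y / x * y}.
Proof. exact/freeprod_lift_is_multiplicative/mapM. Qed.

Lemma freeprod_map_in i (a : H i) :
  freeprod_map (freeprod_in H i a) = freeprod_in K (s i) (phi a).
Proof. exact/freeprod_lift_in/mapM. Qed.

End FreeProductMap.

Lemma isomorphic_of_bijective (G K : groupType) (f : G -> K) :
  {morph f : x y / x * y} -> bijective f -> isomorphic G K.
Proof.
move=> fM f_bij; pose f' : {multiplicative G -> K} :=
  HB.pack_for {multiplicative G -> K} f (isMultiplicative.Build G K f fM).
by exists f'.
Qed.

(** * Factors of order two and the infinite dihedral group *)

Section OrderTwo.

Definition order_two (G : groupType) (h : G) := h <> 1 /\ forall a : G, a <> 1 -> a = h.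

Lemma order_two_sqr (G : groupType) (h : G) : order_two h -> h * h = 1.
Proof.
case=> h_neq1 hE; have [//|/eqP/hE hh] := eqVneq (h * h) 1.
by case: h_neq1; apply: (mulgI h); rewrite hh mulg1.
Qed.

Definition order_two_map (G K : groupType) (k : K) (a : G) : K :=
  if a == 1 then 1 else k.

Lemma order_two_mapM (G K : groupType) (h : G) (k : K) :
  order_two h -> order_two k -> {morph @order_two_map G K k : a b / a * b}.
Proof.
move=> oh ok a b; rewrite /order_two_map; case: (eqVneq a 1) => [->|/eqP/oh.2 ->].
  by rewrite !mul1g.
have /eqP/negbTE h_neq1 := oh.1.
case: (eqVneq b 1) => [->|/eqP/oh.2 ->]; first by rewrite !mulg1 h_neq1.
by rewrite order_two_sqr // eqxx order_two_sqr.
Qed.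

Lemma order_two_mapK (G K : groupType) (h : G) (k : K) : order_two h -> order_two k ->
  cancel (@order_two_map G K k) (order_two_map h).
Proof.
move=> oh ok a; rewrite /order_two_map; case: (eqVneq a 1) => [->|/eqP/oh.2 ->].
  by rewrite eqxx.
by case: eqP => // /ok.1.
Qed.

Lemma freeprod_order_two_isomorphic (I J : choiceType) (H : I -> groupType)
    (K : J -> groupType) (s : I -> J) (h : forall i, H i) (k : forall j, K j) :
  bijective s -> (forall i, order_two (h i)) -> (forall j, order_two (k j)) ->
  isomorphic (freeprod H) (freeprod K).
Proof.
move=> [t stK tsK] oh ok.
have mapM := freeprod_mapM (fun i => order_two_mapM (oh i) (ok (s i))).
have map'M := freeprod_mapM (fun j => order_two_mapM (ok j) (oh (t j))).
apply: (isomorphic_of_bijective mapM).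
exists (freeprod_map (fun j => @order_two_map (K j) (H (t j)) (h (t j)))).
  apply: freeprod_hom_eq => // [x y|i a]; first by rewrite mapM map'M.
  rewrite freeprod_map_in ?freeprod_map_in.
  (* [t (s i)] equals [i] only propositionally, hence the generalised index. *)
  have E i' : i' = i -> freeprod_in H i' (order_two_map (h i') (order_two_map (k (s i)) a))
      = freeprod_in H i a by move=> ->; rewrite order_two_mapK.
    exact: E (stK i).
  by move=> i'; exact: order_two_mapM (ok _) (oh _).
  by move=> i'; exact: order_two_mapM (oh _) (ok _).
apply: freeprod_hom_eq => // [x y|i a]; first by rewrite map'M mapM.
rewrite freeprod_map_in ?freeprod_map_in.
have E i' : i' = i -> freeprod_in K i' (order_two_map (k i') (order_two_map (h (t i)) a))
    = freeprod_in K i a by move=> ->; rewrite order_two_mapK.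
  exact: E (tsK i).
by move=> i'; exact: order_two_mapM (oh _) (ok _).
by move=> i'; exact: order_two_mapM (ok _) (oh _).
Qed.

Lemma order_two_I2 : order_two (ord_max : 'I_2).
Proof.
split=> [/(congr1 val)//|a a_neq1]; apply: val_inj.
by case: a a_neq1 => -[|[|//]] // lt02 []; apply: val_inj.
Qed.

End OrderTwo.

(** Ping-pong needs a non-trivial element of one factor and two distinct non-trivial syllables
    outside it. These are missing only for two factors of order two. *)
Lemma freeprod_free_tuple (n : nat) (H : 'I_n -> groupType) : 2 <= n ->
  (forall i, exists h : H i, h <> 1) -> ~ isomorphic (freeprod H) Dinfty ->
  exists g : nat -> freeprod H,
    forall u, free_reduced u -> u != [::] -> eval_word g u <> 1.
Proof.
move=> n_ge2 H_nontriv not_Dinfty.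
suff [j [b [s1 [s2 [b1 [s11 s21] [s1j s2j s12]]]]]] :
  exists (j : 'I_n) (b : H j) (s1 s2 : {i : 'I_n & H i}),
    [/\ b <> 1, tagged s1 <> 1 /\ tagged s2 <> 1 & [/\ tag s1 != j, tag s2 != j & s1 <> s2]].
  exists (schottky (freeprod_in H j b) (syl_in s1) (syl_in s2)) => u u_red u_neq0.
  by apply/eqP; apply: freeprod_schottky.
have other (i : 'I_n) : exists j : 'I_n, i != j.
  case: n n_ge2 H H_nontriv not_Dinfty i => [|[|n]] // _ _ _ _ i.
  by have [->|i0] := eqVneq i ord0; [exists ord_max | exists ord0].
have [[i [a [c [a1 c1 ac]]]]|no2] :=
  pselect (exists i (a c : H i), [/\ a <> 1, c <> 1 & a <> c]).
  have [j ij] := other i; have [b b1] := H_nontriv j.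
  exists j, b, (Tagged H a), (Tagged H c); split=> //; split=> //.
  by move/eqP; rewrite eq_Tagged /= => /eqP.
have [n2|n_gt2] := leqP n 2.
  have {n2}n2 : n = 2 by apply/eqP; rewrite eqn_leq n2.
  subst n; case: not_Dinfty; pose h i := projT1 (cid (H_nontriv i)).
  have bij : bijective (fun i : 'I_2 => i == ord0).
    exists (fun b : bool => if b then ord0 else ord_max) => [i|[]] //.
    by apply: val_inj; case: i => -[|[|//]].
  apply: (freeprod_order_two_isomorphic bij (h := h)) => i; last exact: order_two_I2.
  split=> [|a a1]; first exact: projT2 (cid (H_nontriv i)).
  have [//|ah] := pselect (a = h i).
  case: no2; exists i, a, (h i); split=> //.
  exact: projT2 (cid (H_nontriv i)).
pose o0 := Ordinal (ltnW (ltnW n_gt2)); have [b b1] := H_nontriv o0.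
pose o1 := Ordinal (ltnW n_gt2); have [a a1] := H_nontriv o1.
pose o2 := Ordinal n_gt2; have [c c1] := H_nontriv o2.
by exists o0, b, (Tagged H a), (Tagged H c); split.
Qed.

(** * Equations *)

Section FreeEval.

Definition tcat (T : Type) (m n : nat) (g : 'I_m -> T) (h : 'I_n -> T)
    (i : 'I_(m + n)) : T :=
  match split i with inl a => g a | inr b => h b end.

Lemma tcat_lshift T m n (g : 'I_m -> T) (h : 'I_n -> T) i : tcat g h (lshift n i) = g i.
Proof. by rewrite /tcat (unsplitK (inl i)). Qed.

Lemma tcat_rshift T m n (g : 'I_m -> T) (h : 'I_n -> T) i : tcat g h (rshift m i) = h i.
Proof. by rewrite /tcat (unsplitK (inr i)). Qed.

Lemma tcatP m n (P : 'I_(m + n) -> Prop) :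
  (forall i, P (lshift n i)) -> (forall i, P (rshift m i)) -> forall i, P i.
Proof. by move=> Pl Pr i; rewrite -(splitK i); case: split. Qed.

Lemma morph_free_eval n (G K : groupType) (f : G -> K) (g : 'I_n -> G) w :
  {morph f : x y / x * y} -> f (free_eval g w) = free_eval (f \o g) w.
Proof. exact: morph_eval_word. Qed.

Lemma eq_free_eval n (G : groupType) (g g' : 'I_n -> G) w :
  g =1 g' -> free_eval g w = free_eval g' w.
Proof. by move=> gg'; apply: eq_eval_word => l _. Qed.

End FreeEval.

Section TestElement.
Variables (n : nat) (n_ge2 : (2 <= n)%N) (H : 'I_n -> groupType).
Hypotheses (H_nontrivial : forall i : 'I_n, exists h : H i, h <> 1)
    (H_law : forall i : 'I_n, satisfies_nontrivial_law (H i))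
    (H_not_Dinfty : ~ isomorphic (freeprod H) Dinfty).
Local Notation FP := (freeprod H).

Lemma test_element (k : nat) (t : 'I_k -> FP) :
  exists (e : nat) (s : 'I_e -> FP) (w : free_group (k + e)),
    forall g : 'I_(k + e) -> FP, free_eval g w = free_eval (tcat t s) w ->
    exists c, forall i, g (lshift e i) = c * t i * c^-1.
Proof.
have [g g_free] := freeprod_free_tuple n_ge2 H_nontrivial H_not_Dinfty.
have [u [u_neq0 u_red u_law]] := common_law_word (enum 'I_n) H_law.
have [N uN] := letters_belowP u.
(* [N] letters for the law [u], one more for the conjugator [r]. *)
exists N.+1, (fun l => g l).
set E := free_eval (tcat t (fun l : 'I_N.+1 => g l)).
pose phi l : free_group (k + N.+1) := pgen _ (rshift k (inord l)).
have EM : {morph E : x y / x * y} by apply: free_eval_is_multiplicative.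
have E_phi l : l <= N -> E (phi l) = g l.
  by move=> lN; rewrite /E free_eval_gen tcat_rshift inordK.
pose v := eval_word phi u; pose r := phi N.
have Ev : E v = eval_word g u.
  rewrite /v morph_eval_word //; apply: eq_eval_word => l /(allP uN) lN.
  by rewrite /= E_phi // ltnW.
have not_comm : ~ commute (E v) (E r * E v * (E r)^-1).
  rewrite /r E_phi // Ev => comm.
  (* The letter [N] does not occur in [u], so the commutator of [u] with [y u y^-1] is reduced as
     written and cannot vanish on a free tuple. *)
  pose y := [:: (N, false)].
  have := @g_free (flatten [:: u; y; u; inv_word y; inv_word u; y; inv_word u; inv_word y]).
  have uy : apart u y.
    by apply/allP=> l /(allP uN) lN; rewrite /= andbT neq_ltn lN.
  have inv_neq0 : inv_word u != [::] by rewrite -size_eq0 size_rev size_map size_eq0.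
  have y_eval : eval_word g y = g N by rewrite /y eval_word_cons eval_word_nil mulg1.
  have y_red : free_reduced y by [].
  have y_neq0 : y != [::] by [].
  have yV_neq0 : inv_word y != [::] by [].
  move: y uy y_eval y_red y_neq0 yV_neq0 => y uy y_eval y_red y_neq0 yV_neq0; case.
  - apply: free_reduced_flatten.
      by rewrite /= !free_reduced_inv u_red u_neq0 inv_neq0 y_red y_neq0 yV_neq0.
    by rewrite /= !(apart_invl, apart_invr) uy apartC uy.
  - by case: (u) u_neq0.
  rewrite /= cats0 !eval_word_cat !eval_inv_word y_eval.
  move: comm; rewrite /commute.
  set a := eval_word g u; set b := g N => comm.
  have -> : a * (b * (a * (b^-1 * (a^-1 * (b * (a^-1 * b^-1)))))) =
            a * (b * a * b^-1) * (b * a * b^-1 * a)^-1 by gsimp.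
  by rewrite comm mulgV.
have cart_v : F_valued FP (@cartesian _ H) _ v.
  move=> f fM i; rewrite /v !morph_eval_word //; last exact: retractionM.
  exact: u_law (mem_enum _ _) _.
have hyp_v : hyp FP (@len _ H) (E v).
  apply: cartesian_hyp; first exact: cart_v.
  by move=> Ev1; apply: not_comm; rewrite Ev1 mulg1 mulgV; apply: commute1.
have [w wP] := @rigid_tuple FP (@len _ H) (@len_ge0 _ H) (@len1 _ H) (@len0_eq1 _ H)
  (@lenV _ H) (@len_four_point _ H) (@cartesian _ H) (@cartesianM _ H) (@cartesianV _ H)
  (@cartesianJ _ H) (@cartesian_hyp _ H) _ E EM k (fun i => pgen _ (lshift N.+1 i)) v r
  cart_v hyp_v not_comm.
exists w => g' g'w.
have [c cP] := wP _ (free_eval_is_multiplicative g') g'w.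
exists c => i; have := cP i.
by rewrite free_eval_gen => ->; rewrite /E free_eval_gen tcat_lshift.
Qed.

End TestElement.

Section Coefficients.
Variables (n : nat) (H : groupType).

Definition assign (G : groupType) (f : H -> G) (g : 'I_n -> G) (t : 'I_n + H) : G :=
  match t with inl i => g i | inr h => f h end.

(** One word serves all [G], [f] and [g]; in it the constants are letters, ready to be replaced by
    unknowns. *)
Lemma coef_eval_word (x : coef_group n H) : exists u : word ('I_n + H)%type,
  forall (G : groupType) (f : {multiplicative H -> G}) (g : 'I_n -> G),
    coef_eval f g x = eval_word (assign f g) u.
Proof.
rewrite -(nfK x); elim: (nf x) => [|s w [u uE]].
  exists [::] => G f g; rewrite value_nil eval_word_nil.
  by apply: (mulgI (coef_eval f g 1)); rewrite -coef_eval_is_multiplicative !mulg1.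
pose v := match s with existT b a =>
  (if b return coef_factor n H b -> word ('I_n + H)%type
   then fun h => [:: (inr h, false)]
   else fun w => [seq (inl l.1, l.2) | l <- repr w]) a end.
exists (v ++ u) => G f g.
rewrite value_cons coef_eval_is_multiplicative uE eval_word_cat; congr (_ * _).
case: s @v => -[] a /=.
  by rewrite coef_eval_const eval_word_cons eval_word_nil mulg1.
rewrite /coef_eval freeprod_lift_in.
  by rewrite /free_eval /plift /eval_word big_map.
by case; [exact: gmulfM | exact: free_eval_is_multiplicative].
Qed.

End Coefficients.

Lemma free_eval_comp (m n : nat) (G : groupType) (g : 'I_n -> G)
    (h : 'I_m -> free_group n) w :
  free_eval g (free_eval h w) = free_eval (free_eval g \o h) w.
Proof. exact/morph_free_eval/free_eval_is_multiplicative. Qed.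

Theorem corollary2 (n : nat) (n_ge2 : (2 <= n)%N) (H : 'I_n -> groupType)
    (H_nontrivial : forall i : 'I_n, exists h : H i, h <> 1%g)
    (H_law : forall i : 'I_n, satisfies_nontrivial_law (H i))
    (H_not_Dinfty : ~ isomorphic (freeprod H) Dinfty) :
  strongly_verbally_closed (freeprod H).
Proof.
move=> G f f_inj f_closed p m w [g gP].
have fM : {morph f : x y / x * y} by exact: gmulfM.
have f1 : f 1 = 1 by apply: (mulgI (f 1)); rewrite -fM !mulg1.
have /choice[u uE] : forall j, exists u : word ('I_p + freeprod H)%type,
    forall (G : groupType) (f : {multiplicative freeprod H -> G}) (g : 'I_p -> G),
    coef_eval f g (w j) = eval_word (assign f g) u.
  by move=> j; apply: coef_eval_word.
pose consts (l : ('I_p + freeprod H)%type * bool) := if l.1 is inr h then [:: h] else [::].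
pose hs := flatten [seq flatten (map consts (u j)) | j <- enum 'I_m].
have in_hs j l h : l \in u j -> l.1 = inr h -> h \in hs.
  move=> lu lh; apply/flattenP; exists (flatten (map consts (u j))).
    by apply/mapP; exists j; rewrite ?mem_enum.
  apply/flattenP; exists (consts l); first exact: map_f.
  by rewrite /consts lh mem_head.
pose K := size hs; pose y (k : 'I_K) := nth 1 hs k.
(* The entries [1] are the required values of the left-hand sides, which conjugation preserves. *)
pose t : 'I_(K + m) -> freeprod H := tcat y (fun=> 1).
have [e [s [v vP]]] := test_element n_ge2 H_nontrivial H_law H_not_Dinfty t.
pose N := p + K + e.
pose X i : free_group N := pgen _ (lshift e (lshift K i)).
pose Y k : free_group N := pgen _ (lshift e (rshift p k)).
pose S i : free_group N := pgen _ (rshift (p + K) i).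
(* The default [1] is never met: [hs] lists all constants of the system. *)
pose C h := if insub (index h hs) is Some k then Y k else 1.
have C_eval (L : groupType) (q : 'I_N -> L) (c : freeprod H -> L) :
    (forall k, free_eval q (Y k) = c (y k)) -> forall h, h \in hs -> free_eval q (C h) = c h.
  move=> qc h hhs; rewrite /C; case: insubP => [k _ kE|]; last by rewrite index_mem hhs.
  by rewrite qc /y kE nth_index.
(* The left-hand sides of the system with constants replaced by the unknowns [Y]. *)
pose U j := eval_word (assign C X) (u j).
have U_eval (L : groupType) (q : 'I_N -> L) j :
    free_eval q (U j) = eval_word (assign (free_eval q \o C) (free_eval q \o X)) (u j).
  rewrite /U morph_eval_word; last exact: free_eval_is_multiplicative.
  by apply: eq_eval_word => -[[]].
pose V := free_eval (tcat (tcat Y U) S) v.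
have V_eval (L : groupType) (q : 'I_N -> L) :
    free_eval q V = free_eval (tcat (tcat (free_eval q \o Y) (free_eval q \o U))
                                    (free_eval q \o S)) v.
  rewrite /V free_eval_comp; apply: eq_free_eval.
  apply: tcatP => [|i]; last by rewrite /= !tcat_rshift.
  by apply: tcatP => i; rewrite /= !(tcat_lshift, tcat_rshift).
(* In [G] the given solution, with the constants for [Y] and [s] for the auxiliary unknowns, takes
   [V] to a value in the subgroup; verbal closedness moves this solution into the subgroup. *)
have [|k kP] := f_closed N V (free_eval (tcat t s) v).
  exists (tcat (tcat g (f \o y)) (f \o s)); rewrite V_eval morph_free_eval //.
  apply: eq_free_eval; apply: tcatP => [|i]; last first.
    by rewrite /= !tcat_rshift /= /S free_eval_gen tcat_rshift.
  have qY k : free_eval (tcat (tcat g (f \o y)) (f \o s)) (Y k) = f (y k).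
    by rewrite /Y free_eval_gen tcat_lshift tcat_rshift.
  apply: tcatP => i /=; rewrite /t !(tcat_lshift, tcat_rshift) /=; first exact: qY.
  rewrite f1 U_eval -(gP i) uE; apply: eq_eval_word => -[[j|h] b] lu /=.
    by rewrite /X free_eval_gen !tcat_lshift.
  by apply: (C_eval _ _ f) => //; apply: in_hs lu _.
have {}kP : free_eval k V = free_eval (tcat t s) v.
  by apply: f_inj; rewrite morph_free_eval.
rewrite V_eval in kP; have [c cP] := vP _ kP.
have Yc i : free_eval k (Y i) = c * y i * c^-1.
  by have := cP (lshift m i); rewrite /t !tcat_lshift.
have Uc j : free_eval k (U j) = 1.
  by have := cP (rshift K j); rewrite /t tcat_lshift !tcat_rshift /= => ->; gsimp.
(* Conjugating back by [c] turns the values of [Y] into the true constants. *)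
exists (fun i => c^-1 * free_eval k (X i) * c) => j.
rewrite uE; transitivity (f (c^-1 * free_eval k (U j) * c)); last first.
  by rewrite Uc mulg1 mulVg.
pose J x := f (c^-1 * x * c).
have JM : {morph J : x y / x * y} by move=> x x'; rewrite /J -fM; gsimp.
rewrite -/(J _) U_eval morph_eval_word //; apply: eq_eval_word => -[[i|h] b] lu //=.
rewrite (C_eval _ _ (fun h => c * h * c^-1)) ?(in_hs j _ _ lu) // /J.
by gsimp.
Qed.
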